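(* Let $S$ be a finite nonempty subset of $\mathbb{Z}$ and let $\lambda\in H^*$ be such that $\mathrm{supp}(\lambda)\subset S$. Then $L(S,\lambda)$ is an integrable $\mathfrak{gl}_\infty$-module if and only if $\lambda\in P_+(S)$.
   Context: All vector spaces are over $\mathbb{C}$; $\mathbb{N}=\{0,1,2,\dots\}$. $\mathfrak{gl}_\infty$ is the Lie algebra of doubly infinite matrices (indexed by $\mathbb{Z}\times\mathbb{Z}$) with finitely many nonzero entries, with basis the matrix units $E_{m,n}$ ($m,n\in\mathbb{Z}$) and $[E_{m,n},E_{r,s}]=\delta_{n,r}E_{m,s}-\delta_{m,s}E_{r,n}$. $H=\mathrm{span}\{E_{n,n}: n\in\mathbb{Z}\}$. A $\mathfrak{gl}_\infty$-module is integrable if every $E_{n,n}$ acts semisimply and every $E_{p,q}$, $p\ne q$, acts locally nilpotently. For a finite nonempty $S\subset\mathbb{Z}$ put $\mathfrak{gl}_S=\mathrm{span}\{E_{m,n}: m,n\in S\}$, $H_S=\mathrm{span}\{E_{n,n}:n\in S\}$, $\mathfrak{gl}_\infty^{(S,+)}=\mathrm{span}\{E_{m,n}: m\in\mathbb{Z},\ n\notin S\}$. For a $\mathfrak{gl}_S$-module $U$, let $\mathfrak{gl}_\infty^{(S,+)}$ act trivially on $U$, and set $M(S,U)=U(\mathfrak{gl}_\infty)\otimes_{U(\mathfrak{gl}_\infty^{(S,+)}+\mathfrak{gl}_S)}U$. If $U$ is irreducible, $M(S,U)$ has a unique irreducible quotient. For $\lambda\in H^*$, $\mathrm{supp}(\lambda)=\{m\in\mathbb{Z}:\lambda(E_{m,m})\neq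 0\}$. If $\mathrm{supp}(\lambda)\subset S$, let $\lambda_S=\lambda|_{H_S}$ and let $L(\lambda_S)$ be the irreducible highest weight $\mathfrak{gl}_S$-module of highest weight $\lambda_S$ with respect to the positive part $\mathrm{span}\{E_{m,n}: m,n\in S,\ m<n\}$. $L(S,\lambda)$ is the irreducible quotient of $M(S,L(\lambda_S))$. $P_+(S)$ is the set of $\lambda\in H^*$ such that $\lambda(E_{i,i})\in\mathbb{N}$ for all $i\in\mathbb{Z}$, $\lambda(E_{i,i})=0$ whenever $i\notin S$, and $\lambda(E_{i,i})\ge\lambda(E_{j,j})$ for all $i,j\in S$ with $i<j$. *)

(* Defs.v *)
From HB Require Import structures.
From mathcomp Require Import all_boot all_order all_algebra.
From mathcomp Require Import generic_quotient ring_quotient.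
From mathcomp Require Import finmap boolp reals complex.
From mathcomp Require Import monalg.

Set Implicit Arguments.
Unset Strict Implicit.
Unset Printing Implicit Defensive.

Import Order.TTheory GRing.Theory Num.Theory.

Local Open Scope ring_scope.
Local Open Scope quotient_scope.

Inductive lspan (K : fieldType) (V : lmodType K) (G : V -> Prop) : V -> Prop :=
| lspan0 : lspan G 0
| lspanG (a : K) (r v : V) : G r -> lspan G v -> lspan G (a *: r + v).

Section Quotient.
Variables (K : fieldType) (V : lmodType K) (G : V -> Prop).

Lemma lspan_gen r : G r -> lspan G r.
Proof.
by move=> Gr; rewrite -[r]scale1r -[_ *: _]addr0; apply: lspanG => //; constructor.
Qed.

Lemma lspanD u v : lspan G u -> lspan G v -> lspan G (u + v).
Proof.
move=> Gu Gv; elim: Gu => [|a r w Gr _ IH]; first by rewrite add0r.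
by rewrite -addrA; apply: lspanG.
Qed.

Lemma lspanZ c v : lspan G v -> lspan G (c *: v).
Proof.
elim=> [|a r w Gr _ IH]; first by rewrite scaler0; constructor.
by rewrite scalerDr scalerA; apply: lspanG.
Qed.

Lemma lspanN v : lspan G v -> lspan G (- v).
Proof. by rewrite -scaleN1r; apply: lspanZ. Qed.

Definition lspanb : {pred V} := fun v => `[< lspan G v >].

Lemma lspanbP v : reflect (lspan G v) (v \in lspanb).
Proof. exact: asboolP. Qed.

Fact lspanb_zmod_closed : zmod_closed lspanb.
Proof.
split=> [|u v /lspanbP Gu /lspanbP Gv]; apply/lspanbP; first by constructor.
by apply: lspanD => //; apply: lspanN.
Qed.

HB.instance Definition _ := GRing.isZmodClosed.Build V lspanb lspanb_zmod_closed.

Definition lquot := Quotient.quot lspanb.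

HB.instance Definition _ := GRing.Zmodule.on lquot.

(* The projection and its section; locked to keep the unifier out of repr. *)
Definition lpi : V -> lquot := locked (fun v => \pi_lquot v).
Definition lrep : lquot -> V := locked (fun q => repr q).

Lemma lpiE v : lpi v = \pi_lquot v. Proof. by rewrite /lpi -lock. Qed.
Lemma lrepK : cancel lrep lpi.
Proof. by move=> q; rewrite lpiE /lrep -lock reprK. Qed.

Lemma lpiP u v : lpi u = lpi v <-> lspan G (u - v).
Proof.
rewrite !lpiE; split=> [/eqP|/lspanbP].
  by rewrite -[_ == _]Quotient.idealrBE => /lspanbP.
by rewrite Quotient.idealrBE => /eqP.
Qed.

Lemma lpi_eq0 v : lspan G v -> lpi v = lpi 0.
Proof. by move=> Gv; apply/lpiP; rewrite subr0. Qed.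

Lemma lpiD u v : lpi (u + v) = lpi u + lpi v.
Proof. by rewrite !lpiE; exact: (@pi_addr _ _ _ _ _ lquot u v). Qed.

Lemma lrep_lpi v : lspan G (lrep (lpi v) - v).
Proof. by apply/lpiP; rewrite lrepK. Qed.

Definition lquot_scale : K -> lquot -> lquot :=
  locked (fun a q => lpi (a *: lrep q)).

Lemma lquot_scaleE a v : lquot_scale a (lpi v) = lpi (a *: v).
Proof.
rewrite /lquot_scale -lock.
by apply/lpiP; rewrite -scalerBr; apply/lspanZ/lrep_lpi.
Qed.

Fact lquot_scaleA a b q : lquot_scale a (lquot_scale b q) = lquot_scale (a * b) q.
Proof. by rewrite -[q]lrepK !lquot_scaleE scalerA. Qed.

Fact lquot_scale1 : left_id 1 lquot_scale.
Proof. by move=> q; rewrite -[q]lrepK lquot_scaleE scale1r. Qed.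

Fact lquot_scaleDr : right_distributive lquot_scale +%R.
Proof.
move=> a p q; rewrite -[p]lrepK -[q]lrepK -lpiD !lquot_scaleE -lpiD.
by rewrite scalerDr.
Qed.

Fact lquot_scaleDl q : {morph lquot_scale^~ q : a b / a + b}.
Proof. by move=> a b; rewrite -[q]lrepK !lquot_scaleE -lpiD scalerDl. Qed.

HB.instance Definition _ := GRing.Zmodule_isLmodule.Build K lquot
  lquot_scaleA lquot_scale1 lquot_scaleDr lquot_scaleDl.

Fact lpi_is_linear : linear lpi.
Proof. by move=> a u v; rewrite lpiD; congr (_ + _); rewrite -lquot_scaleE. Qed.

HB.instance Definition _ := GRing.isLinear.Build K V lquot *:%R lpi lpi_is_linear.

End Quotient.

Lemma lspan_linear (K : fieldType) (V W : lmodType K) (G : V -> Prop)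
    (H : W -> Prop) (f : V -> W) :
  linear f -> (forall r, G r -> lspan H (f r)) ->
  forall v, lspan G v -> lspan H (f v).
Proof.
move=> flin fG v; elim=> [|a r w Gr _ IH].
  have := flin (-1) 0 0; rewrite scaler0 addr0 scaleN1r addNr => ->.
  by constructor.
by rewrite flin; apply: lspanD => //; apply/lspanZ/fG.
Qed.

Section LinearExtension.
Variables (K : fieldType) (I : choiceType) (V : lmodType K).
Implicit Types (f : I -> V) (x y : {malg K[I]}).

Definition lext f x : V := \sum_(k <- msupp x) x@_k *: f k.

Lemma lextw f x (d : {fset I}) : (msupp x `<=` d)%fset ->
  lext f x = \sum_(k <- d) x@_k *: f k.
Proof.
move=> le_xd; apply: big_fset_incl => // k _ kx.
by rewrite mcoeff_outdom // scale0r.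
Qed.

Fact lext_is_linear f : linear (lext f).
Proof.
move=> a x y; pose d := (msupp x `|` msupp y `|` msupp (a *: x + y))%fset.
rewrite (@lextw f x d) ?(@lextw f y d) ?(@lextw f _ d) ?fsubsetUr //.
- rewrite scaler_sumr -big_split; apply: eq_bigr => k _ /=.
  by rewrite mcoeffD mcoeffZ scalerDl scalerA.
- by rewrite /d -fsetUA fsetUCA fsubsetUl.
- by rewrite /d -fsetUA fsubsetUl.
Qed.

HB.instance Definition _ f :=
  GRing.isLinear.Build K {malg K[I]} V *:%R (lext f) (lext_is_linear f).

Lemma lextU f c k : lext f << c *g k >> = c *: f k.
Proof. by rewrite (lextw f msuppU_le) big_seq_fset1 mcoeffUU. Qed.

Lemma lextU1 f k : lext f << k >> = f k.
Proof. by rewrite lextU scale1r. Qed.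

Lemma eq_lext f g : f =1 g -> lext f =1 lext g.
Proof. by move=> fg x; apply: eq_bigr => k _; rewrite fg. Qed.

Lemma lextDf f g x : lext (fun k => f k + g k) x = lext f x + lext g x.
Proof. by rewrite -big_split; apply: eq_bigr => k _; rewrite scalerDr. Qed.

Lemma lextZf a f x : lext (fun k => a *: f k) x = a *: lext f x.
Proof.
by rewrite scaler_sumr; apply: eq_bigr => k _; rewrite !scalerA mulrC.
Qed.

End LinearExtension.

Section LinearExtensionTheory.
Variables (K : fieldType) (I : choiceType).

Lemma malg_eq_lext (x : {malg K[I]}) : x = lext (fun k => << k >>) x.
Proof.
rewrite {1}[x]monalgE; apply: eq_bigr => k _.
by apply/malgP => j; rewrite mcoeffZ !mcoeffU mulr_natr.
Qed.

Lemma linear_malg (V : lmodType K) (f : {malg K[I]} -> V) :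
  linear f -> f =1 lext (fun k => f << k >>).
Proof.
move=> flin x; pose F : {linear {malg K[I]} -> V} :=
  HB.pack f (GRing.isLinear.Build K {malg K[I]} V *:%R f flin).
rewrite -[f]/(F : _ -> _) {1}[x]malg_eq_lext linear_sum.
by apply: eq_bigr => k _; rewrite linearZ.
Qed.

Lemma eq_linear_malg (V : lmodType K) (f g : {malg K[I]} -> V) :
  linear f -> linear g -> (forall k, f << k >> = g << k >>) -> f =1 g.
Proof.
by move=> fl gl fg x; rewrite (linear_malg fl) (linear_malg gl); apply: eq_lext.
Qed.

End LinearExtensionTheory.

HB.mixin Record Lmodule_isLieAlgebra (K : fieldType) L of GRing.Lmodule K L := {
  lie_bracket : L -> L -> L;
  lie_linearl : forall y, linear (lie_bracket^~ y);
  lie_linearr : forall x, linear (lie_bracket x);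
  lie_alternating : forall x, lie_bracket x x = 0;
  lie_jacobi : forall x y z,
    lie_bracket x (lie_bracket y z) + lie_bracket y (lie_bracket z x)
    + lie_bracket z (lie_bracket x y) = 0
}.

#[short(type="lieAlgType")]
HB.structure Definition LieAlgebra (K : fieldType) :=
  {L of GRing.Lmodule K L & Lmodule_isLieAlgebra K L}.

Notation "[ 'lie' x , y ]" := (lie_bracket x y)
  (at level 0, x, y at level 99, format "[ 'lie'  x ,  y ]") : ring_scope.

HB.mixin Record Lmodule_isLieModule (K : fieldType) (L : lieAlgType K) V
    of GRing.Lmodule K V := {
  lact : L -> V -> V;
  lact_linearl : forall v, linear (lact^~ v);
  lact_linearr : forall x, linear (lact x);
  lact_lie : forall x y v, lact [lie x, y] v = lact x (lact y v) - lact y (lact x v)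
}.

#[short(type="lieModType")]
HB.structure Definition LieModule (K : fieldType) (L : lieAlgType K) :=
  {V of GRing.Lmodule K V & Lmodule_isLieModule K L V}.

Definition lie_hom (K : fieldType) (L L' : lieAlgType K) (f : L -> L') :=
  linear f /\ forall x y, f [lie x, y] = [lie f x, f y].

Section LieModules.
Variables (K : fieldType) (L : lieAlgType K).

Definition submodule (V : lieModType L) (W : V -> Prop) :=
  [/\ W 0, forall a u v, W u -> W v -> W (a *: u + v)
    & forall x v, W v -> W (lact x v)].

Definition irreducible (V : lieModType L) :=
  (exists v : V, v != 0) /\
  forall W : V -> Prop, submodule W ->
    (forall v, W v -> v = 0) \/ (forall v, W v).

Definition generated_by (V : lieModType L) (v : V) :=
  forall W : V -> Prop, submodule W -> W v -> forall u, W u.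

Definition module_hom (V W : lieModType L) (f : V -> W) :=
  linear f /\ forall x v, f (lact x v) = lact x (f v).

Definition quotient_of (V W : lieModType L) :=
  exists2 f : V -> W, module_hom f & forall w, exists v, f v = w.

Definition irreducible_quotient (V W : lieModType L) :=
  irreducible W /\ quotient_of V W.

End LieModules.

(* Over an algebraically closed field a K[T]-module is semisimple iff it is    *)
(* the sum of the eigenspaces of T.                                           *)
Definition acts_semisimply (K : fieldType) (V : lmodType K) (T : V -> V) :=
  forall v, exists2 s : seq V,
    (forall w, w \in s -> exists c : K, T w = c *: w) & v = \sum_(w <- s) w.

Definition locally_nilpotent (K : fieldType) (V : lmodType K) (T : V -> V) :=
  forall v, exists N : nat, iter N T v = 0.

Lemma morph_commutator (A : pzRingType) (V : zmodType) (e : A -> V)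
    (h : A -> A -> V) :
  (forall p q, e (p - q) = e p - e q) -> (forall p q, e (p * q) = h p q) ->
  forall p q, e (p * q - q * p) = h p q - h q p.
Proof. by move=> eB eM p q; rewrite eB !eM. Qed.

Section AlgebraQuotient.
Variables (K : fieldType) (A : algType K) (R : A -> Prop).
Implicit Types s t r : A.

Inductive ideal_rel : A -> Prop :=
| IdealRel s r t : R r -> ideal_rel (s * r * t).

Definition aquot := lquot ideal_rel.
HB.instance Definition _ := GRing.Lmodule.on aquot.

Definition api (s : A) : aquot := lpi ideal_rel s.
Definition arep (a : aquot) : A := lrep a.

Lemma api_linear : linear api. Proof. exact: lpi_is_linear. Qed.
HB.instance Definition _ := GRing.isLinear.Build K A aquot *:%R api api_linear.

Lemma arepK : cancel arep api. Proof. exact: lrepK. Qed.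

Lemma api_eq s t : lspan ideal_rel (s - t) -> api s = api t.
Proof. by move=> st; apply/lpiP. Qed.

Lemma api_rel s t : R (s - t) -> api s = api t.
Proof.
move=> Rst; apply/api_eq/lspan_gen.
by rewrite -[_ - _]mul1r -[_ * _]mulr1; apply: IdealRel.
Qed.

Lemma ideal_relMl s r : lspan ideal_rel r -> lspan ideal_rel (s * r).
Proof.
apply: (@lspan_linear _ _ _ _ _ (fun r => s * r)) => [a u v|{}r].
  by rewrite mulrDr scalerAr.
by case=> s' {}r t Rr; rewrite !mulrA; apply/lspan_gen/IdealRel.
Qed.

Lemma ideal_relMr r s : lspan ideal_rel r -> lspan ideal_rel (r * s).
Proof.
apply: (@lspan_linear _ _ _ _ _ (fun r => r * s)) => [a u v|{}r].
  by rewrite mulrDl -scalerAl.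
by case=> s' {}r t Rr; rewrite -mulrA; apply/lspan_gen/IdealRel.
Qed.

Definition aquot_one : aquot := api 1.
Definition aquot_mul : aquot -> aquot -> aquot :=
  locked (fun a b => api (arep a * arep b)).

Lemma aquot_mulE s t : aquot_mul (api s) (api t) = api (s * t).
Proof.
rewrite /aquot_mul -lock; apply: api_eq; set s' := arep _; set t' := arep _.
have -> : s' * t' - s * t = s' * (t' - t) + (s' - s) * t.
  by rewrite mulrBr mulrBl addrA subrK.
apply: lspanD; first exact/ideal_relMl/lrep_lpi.
exact/ideal_relMr/lrep_lpi.
Qed.

Lemma aquot_mulA : associative aquot_mul.
Proof.
by move=> a b c; rewrite -[a]arepK -[b]arepK -[c]arepK !aquot_mulE mulrA.
Qed.
Lemma aquot_mul1 : left_id aquot_one aquot_mul.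
Proof. by move=> a; rewrite -[a]arepK aquot_mulE mul1r. Qed.
Lemma aquot_mulr1 : right_id aquot_one aquot_mul.
Proof. by move=> a; rewrite -[a]arepK aquot_mulE mulr1. Qed.
Lemma aquot_mulDl : left_distributive aquot_mul +%R.
Proof.
move=> a b c; rewrite -[a]arepK -[b]arepK -[c]arepK -linearD !aquot_mulE.
by rewrite -linearD mulrDl.
Qed.
Lemma aquot_mulDr : right_distributive aquot_mul +%R.
Proof.
move=> a b c; rewrite -[a]arepK -[b]arepK -[c]arepK -linearD !aquot_mulE.
by rewrite -linearD mulrDr.
Qed.
Lemma aquot_scaleAl (k : K) a b :
  k *: aquot_mul a b = aquot_mul (k *: a) b.
Proof.
by rewrite -[a]arepK -[b]arepK aquot_mulE -!linearZ aquot_mulE scalerAl.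
Qed.
Lemma aquot_scaleAr (k : K) a b :
  k *: aquot_mul a b = aquot_mul a (k *: b).
Proof.
by rewrite -[a]arepK -[b]arepK aquot_mulE -!linearZ aquot_mulE scalerAr.
Qed.

Lemma aquot_one_neq0 (e : {rmorphism A -> K}) :
  scalable_for *%R e -> (forall r, R r -> e r = 0) -> aquot_one != 0.
Proof.
move=> eZ eR; apply/eqP; rewrite -[0 in RHS](linear0 api) => /lpiP; rewrite subr0.
suff H u : lspan ideal_rel u -> e u = 0.
  by move/H/eqP; rewrite rmorph1 oner_eq0.
elim=> [|a r v [s {}r t Rr] _ IH]; first exact: rmorph0.
by rewrite rmorphD eZ !rmorphM (eR _ Rr) IH mulr0 mul0r mulr0 addr0.
Qed.

End AlgebraQuotient.

Section FreeAlgebra.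
Variables (K : fieldType) (I : choiceType).

Definition fralg := {malg K[{fmonom I}]}.
HB.instance Definition _ := GRing.Lalgebra.on fralg.

Fact fralg_scaleAr (k : K) (s t : fralg) : k *: (s * t) = s * (k *: t).
Proof.
rewrite (malgMEw (fsubset_refl _) (@msuppZ_le _ _ k t)) malgME scaler_sumr.
apply: eq_bigr => i _; rewrite scaler_sumr; apply: eq_bigr => j _.
apply/malgP => w; rewrite [LHS]mcoeffZ [X in k * X = _]mcoeffU [RHS]mcoeffU.
by rewrite [in RHS]mcoeffZ mulrCA mulrnAr.
Qed.

HB.instance Definition _ := GRing.Lalgebra_isAlgebra.Build K fralg fralg_scaleAr.

(* The basis vectors are locked so that the unifier does not open malg. *)
Definition fword : {fmonom I} -> fralg := locked (fun w => << w >>).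
Lemma fwordE w : fword w = << w >>. Proof. by rewrite /fword -lock. Qed.
Definition fgen (x : I) : fralg := fword (fmu x).

Lemma fwordM v w : fword v * fword w = fword (mmul v w).
Proof. by rewrite !fwordE malgM_def fgmulUU mulr1. Qed.

Definition fext (V : lmodType K) (f : {fmonom I} -> V) : fralg -> V := lext f.
Fact fext_is_linear V f : linear (@fext V f). Proof. exact: lext_is_linear. Qed.
HB.instance Definition _ (V : lmodType K) (f : {fmonom I} -> V) :=
  GRing.isLinear.Build K fralg V *:%R (@fext V f) (fext_is_linear f).

Lemma fext_word V f w : @fext V f (fword w) = f w.
Proof. by rewrite fwordE /fext lextU1. Qed.

Lemma eq_fralg (V : lmodType K) (f g : fralg -> V) :
  linear f -> linear g -> (forall w, f (fword w) = g (fword w)) -> f =1 g.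
Proof.
by move=> fl gl fg; apply: eq_linear_malg fl gl _ => w; rewrite -fwordE.
Qed.

Definition fcoef1 (s : fralg) : K := mcoeff mone (s : {malg K[{fmonom I}]}).
Fact fcoef1_zmod : zmod_morphism fcoef1.
Proof. by move=> s t; rewrite /fcoef1 mcoeffB. Qed.
Fact fcoef1_monoid : monoid_morphism fcoef1.
Proof.
split; first by rewrite /fcoef1 mcoeff1 eqxx.
by move=> s t; rewrite /fcoef1 (rmorphM (mcoeff mone : {rmorphism {malg K[{fmonom I}]} -> K})).
Qed.
HB.instance Definition _ := GRing.isZmodMorphism.Build fralg K fcoef1 fcoef1_zmod.
HB.instance Definition _ := GRing.isMonoidMorphism.Build fralg K fcoef1 fcoef1_monoid.

Lemma fcoef1Z : scalable_for *%R fcoef1.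
Proof. by move=> k s; rewrite /fcoef1 mcoeffZ. Qed.

Lemma fcoef1_gen x : fcoef1 (fgen x) = 0.
Proof.
rewrite /fcoef1 /fgen fwordE mcoeffU; case: eqP => // /(congr1 (@fmonom_val _)).
by rewrite fmU fm1.
Qed.

End FreeAlgebra.

Section Enveloping.
Variables (K : fieldType) (L : lieAlgType K).

Local Notation F := (fralg K L).

(* F is the free associative algebra on the set L; the first two families of  *)
(* relations cut it down to the tensor algebra of the vector space L.         *)
Inductive env_rel : F -> Prop :=
| EnvAdd x y : env_rel (fgen K (x + y) - (fgen K x + fgen K y))
| EnvScale a x : env_rel (fgen K (a *: x) - a *: fgen K x)
| EnvLie x y :
    env_rel (fgen K [lie x, y] - (fgen K x * fgen K y - fgen K y * fgen K x)).

Definition env := aquot env_rel.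
HB.instance Definition _ := GRing.Lmodule.on env.

Implicit Types (s t u : F) (a b c : env).

Definition epi (s : F) : env := api env_rel s.
Definition erep (a : env) : F := arep a.
HB.instance Definition _ := GRing.Linear.copy epi (@api K F env_rel).

Lemma erepK : cancel erep epi. Proof. exact: arepK. Qed.

Fact env_one_neq0 : aquot_one env_rel != 0.
Proof.
apply: (@aquot_one_neq0 _ _ _ (@fcoef1 K L)); first exact: fcoef1Z.
pose c := @fcoef1 K L.
have cB s t : c (s - t) = c s - c t by exact: (@fcoef1_zmod K L).
have cM s t : c (s * t) = c s * c t by exact: (fcoef1_monoid K L).2.
have cD s t : c (s + t) = c s + c t by exact: (raddfD (@fcoef1 K L)).
have cg x : c (fgen K x) = 0 by exact: fcoef1_gen.
suff c0 r : env_rel r -> c r = 0 by exact: c0.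
have cZ k s : c (k *: s) = k * c s by exact: fcoef1Z.
case=> [x y|a x|x y]; rewrite cB cg.
- by rewrite cD !cg addr0 subr0.
- by rewrite cZ cg mulr0 subr0.
by rewrite (morph_commutator cB cM) !cg mulr0 !subr0.
Qed.

HB.instance Definition _ := GRing.Zmodule_isNzRing.Build env
  (@aquot_mulA _ _ env_rel) (@aquot_mul1 _ _ env_rel) (@aquot_mulr1 _ _ env_rel)
  (@aquot_mulDl _ _ env_rel) (@aquot_mulDr _ _ env_rel) env_one_neq0.
HB.instance Definition _ :=
  GRing.Lmodule_isLalgebra.Build K env (@aquot_scaleAl _ _ env_rel).
HB.instance Definition _ :=
  GRing.Lalgebra_isAlgebra.Build K env (@aquot_scaleAr _ _ env_rel).

Lemma epiM s t : epi (s * t) = epi s * epi t.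
Proof. by rewrite [RHS]aquot_mulE. Qed.

Lemma epi1 : epi 1 = 1. Proof. by []. Qed.

Definition env_in (x : L) : env := epi (fgen K x).

Lemma env_in_linear : linear env_in.
Proof.
move=> k x y.
have eD : env_in (k *: x + y) = env_in (k *: x) + env_in y.
  by rewrite /env_in -linearD; apply/api_rel/EnvAdd.
by rewrite eD; congr (_ + _); rewrite /env_in -linearZ; apply/api_rel/EnvScale.
Qed.

Lemma env_in_lie x y :
  env_in [lie x, y] = env_in x * env_in y - env_in y * env_in x.
Proof. by rewrite /env_in -!epiM -linearB; apply/api_rel/EnvLie. Qed.

Lemma epi_lift (V : lmodType K) (f : {linear F -> V}) :
  (forall s r t, env_rel r -> f (s * r * t) = 0) ->
  forall s, f (erep (epi s)) = f s.
Proof.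
move=> f0 s; apply/eqP; rewrite -subr_eq0 -linearB; apply/eqP.
have := lrep_lpi (ideal_rel env_rel) s.
rewrite -/(erep _); elim=> [|k r v [s' {}r t Rr] _ IH]; first exact: linear0.
by rewrite linearP f0 // IH scaler0 addr0.
Qed.

(* The algebra morphism env -> A extending f : L -> A; the choice of          *)
(* representative is harmless when f is linear and satisfies                  *)
(* f [lie x, y] = f x * f y - f y * f x, see env_ext_pi.                      *)
Section Extension.
Variables (A : algType K) (f : L -> A).

Definition fralg_ext : F -> A := fext (fun w : {fmonom L} => \prod_(x <- w) f x).
Definition env_ext a : A := fralg_ext (erep a).

Lemma fralg_ext_linear : linear fralg_ext. Proof. exact: linearP. Qed.
HB.instance Definition _ :=
  GRing.isLinear.Build K F A *:%R fralg_ext fralg_ext_linear.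

Lemma fralg_ext_word (w : {fmonom L}) : fralg_ext (fword K w) = \prod_(x <- w) f x.
Proof. exact: fext_word. Qed.

Lemma fralg_extM s t : fralg_ext (s * t) = fralg_ext s * fralg_ext t.
Proof.
move: s; apply: eq_fralg => [k u v|k u v|w].
- by rewrite mulrDl -scalerAl linearP.
- by rewrite linearP mulrDl scalerAl.
move: t; apply: eq_fralg => [k u v|k u v|v].
- by rewrite mulrDr -scalerAr linearP.
- by rewrite linearP mulrDr scalerAr.
by rewrite fwordM !fralg_ext_word fmM big_cat.
Qed.

Lemma fralg_ext_gen x : fralg_ext (fgen K x) = f x.
Proof. by rewrite fralg_ext_word fmU big_seq1. Qed.

Hypothesis flin : linear f.
Hypothesis flie : forall x y, f [lie x, y] = f x * f y - f y * f x.

Lemma env_ext_pi s : env_ext (epi s) = fralg_ext s.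
Proof.
apply: (epi_lift (f := fralg_ext)) => {}s r t Rr /=.
rewrite (fralg_extM (s * r)) (fralg_extM s).
suff -> : fralg_ext r = 0 by rewrite mulr0 mul0r.
have eB p q : fralg_ext (p - q) = fralg_ext p - fralg_ext q by exact: linearB.
have eD p q : fralg_ext (p + q) = fralg_ext p + fralg_ext q by exact: linearD.
have eZ k q : fralg_ext (k *: q) = k *: fralg_ext q by exact: linearZ.
pose g : {linear L -> A} := HB.pack f (GRing.isLinear.Build K L A *:%R f flin).
have fD x y : f (x + y) = f x + f y by exact: (linearD g).
have fZ k x : f (k *: x) = k *: f x by exact: (linearZZ g).
case: Rr => [x y|k x|x y].
- by rewrite eB eD !fralg_ext_gen fD subrr.
- by rewrite eB eZ !fralg_ext_gen fZ subrr.
by rewrite eB (morph_commutator eB fralg_extM) !fralg_ext_gen flie subrr.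
Qed.

Lemma env_ext_linear : linear env_ext.
Proof.
move=> k a b; rewrite -[a]erepK -[b]erepK -linearP !env_ext_pi.
exact: fralg_ext_linear.
Qed.

Lemma env_ext_in x : env_ext (env_in x) = f x.
Proof. by rewrite env_ext_pi fralg_ext_gen. Qed.

Lemma env_extM a b : env_ext (a * b) = env_ext a * env_ext b.
Proof. by rewrite -[a]erepK -[b]erepK -epiM !env_ext_pi fralg_extM. Qed.

End Extension.

(* The action of env on an L-module: a word x1 ... xn acts as x1 (... (xn v)), *)
(* independently of the representative by env_act_pi.                         *)
Section Action.
Variable V : lieModType L.
Implicit Type v : V.

Definition fralg_act (s : F) v : V :=
  fext (fun w : {fmonom L} => foldr lact v w) s.
Definition env_act (a : env) v : V := fralg_act (erep a) v.

Lemma fralg_act_word (w : {fmonom L}) v : fralg_act (fword K w) v = foldr lact v w.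
Proof. by rewrite /fralg_act fext_word. Qed.

Lemma fralg_act_linearl v : linear (fralg_act^~ v).
Proof. by move=> k s t; rewrite /fralg_act linearP. Qed.

Lemma fralg_act_linearr s : linear (fralg_act s).
Proof.
move=> k u v; rewrite /fralg_act /fext -lextZf -lextDf.
apply: eq_lext => w; elim: (w : seq L) => //= x {}w IH.
by rewrite IH lact_linearr.
Qed.

Lemma fralg_actM s t v : fralg_act (s * t) v = fralg_act s (fralg_act t v).
Proof.
move: s; apply: eq_fralg => [k u w|k u w|w].
- by rewrite mulrDl -scalerAl fralg_act_linearl.
- by rewrite fralg_act_linearl.
move: t; apply: eq_fralg => [k t u|k t u|u].
- by rewrite mulrDr -scalerAr fralg_act_linearl.
- by rewrite fralg_act_linearl fralg_act_linearr.
by rewrite fwordM !fralg_act_word fmM foldr_cat.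
Qed.

Lemma fralg_act_gen x v : fralg_act (fgen K x) v = lact x v.
Proof. by rewrite fralg_act_word fmU. Qed.

Lemma env_act_pi s v : env_act (epi s) v = fralg_act s v.
Proof.
pose g : {linear F -> V} := HB.pack (fralg_act^~ v)
  (GRing.isLinear.Build K F V *:%R (fralg_act^~ v) (fralg_act_linearl v)).
apply: (epi_lift (f := g)) => {}s r t Rr; rewrite -[LHS]/(fralg_act _ v).
rewrite (fralg_actM (s * r)) (fralg_actM s).
pose h (r : F) : {linear V -> V} := HB.pack (fralg_act r)
  (GRing.isLinear.Build K V V *:%R (fralg_act r) (fralg_act_linearr r)).
suff -> : fralg_act r (fralg_act t v) = 0 by exact: (linear0 (h s)).
move: (fralg_act t v) => {g}v.
have aB p q : fralg_act (p - q) v = fralg_act p v - fralg_act q v.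
  by rewrite /fralg_act linearB.
have aD p q : fralg_act (p + q) v = fralg_act p v + fralg_act q v.
  by rewrite /fralg_act linearD.
have aZ k q : fralg_act (k *: q) v = k *: fralg_act q v.
  by rewrite /fralg_act linearZ.
case: Rr => [x y|k x|x y].
- rewrite aB aD !fralg_act_gen.
  by have := lact_linearl v 1 x y; rewrite !scale1r => ->; rewrite subrr.
- rewrite aB aZ !fralg_act_gen.
  have := lact_linearl v k x 0; rewrite addr0 => ->.
  have := lact_linearl v (-1) 0 0; rewrite scaler0 addr0 scaleN1r addNr => ->.
  by rewrite addr0 subrr.
have aC p q : fralg_act (p * q - q * p) v =
    fralg_act p (fralg_act q v) - fralg_act q (fralg_act p v).
  exact: (@morph_commutator _ _ (fralg_act^~ v)
    (fun p q => fralg_act p (fralg_act q v)) aB (fun p q => fralg_actM p q v)).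
by rewrite aB aC !fralg_act_gen lact_lie subrr.
Qed.

Lemma env_act_in x v : env_act (env_in x) v = lact x v.
Proof. by rewrite env_act_pi fralg_act_gen. Qed.

Lemma env_actM a b v : env_act (a * b) v = env_act a (env_act b v).
Proof. by rewrite -[a]erepK -[b]erepK -epiM !env_act_pi fralg_actM. Qed.

Lemma env_act1 v : env_act 1 v = v.
Proof. by rewrite -epi1 env_act_pi -[1]/(<< mone >> : F) -fwordE fralg_act_word fm1. Qed.

Lemma env_act_linearl v : linear (env_act^~ v).
Proof.
move=> k a b; rewrite -[a]erepK -[b]erepK -linearP !env_act_pi.
exact: fralg_act_linearl.
Qed.

Lemma env_act_linearr a : linear (env_act a).
Proof. exact: fralg_act_linearr. Qed.

End Action.

End Enveloping.

Definition env_map (K : fieldType) (P L : lieAlgType K) (phi : P -> L) :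
  env P -> env L := env_ext (fun x => env_in (phi x)).

Section EnvMap.
Variables (K : fieldType) (P L : lieAlgType K) (phi : P -> L).
Hypothesis phi_hom : lie_hom phi.

Fact env_in_phi_linear : linear (fun x => env_in (phi x)).
Proof. by move=> k x y; rewrite phi_hom.1 env_in_linear. Qed.

Fact env_in_phi_lie x y : env_in (phi [lie x, y]) =
  env_in (phi x) * env_in (phi y) - env_in (phi y) * env_in (phi x).
Proof. by rewrite phi_hom.2 env_in_lie. Qed.

Lemma env_map_in x : env_map phi (env_in x) = env_in (phi x).
Proof. exact: env_ext_in env_in_phi_linear env_in_phi_lie x. Qed.

Lemma env_mapM a b : env_map phi (a * b) = env_map phi a * env_map phi b.
Proof. exact: env_extM env_in_phi_linear env_in_phi_lie a b. Qed.

Lemma env_map_linear : linear (env_map phi).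
Proof. exact: env_ext_linear env_in_phi_linear env_in_phi_lie. Qed.

End EnvMap.

Lemma subr_trans3 (V : zmodType) (x y z t : V) :
  x - (y + t) + (y - z) = x - (z + t).
Proof. by rewrite !opprD -addrA addrACA addNr add0r [- t - z]addrC. Qed.

Section Induced.
Variables (K : fieldType) (P L : lieAlgType K) (phi : P -> L) (V : lieModType P).

Definition tens_free := {malg K[(env L * V)%type]}.
HB.instance Definition _ := GRing.Lmodule.on tens_free.
Definition ptens : env L -> V -> tens_free := locked (fun a v => << (a, v) >>).
Lemma ptensE a v : ptens a v = << (a, v) >>. Proof. by rewrite /ptens -lock. Qed.

Inductive tens_rel : tens_free -> Prop :=
| TensAddl a b v : tens_rel (ptens (a + b) v - (ptens a v + ptens b v))
| TensAddr a u v : tens_rel (ptens a (u + v) - (ptens a u + ptens a v))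
| TensScalel k a v : tens_rel (ptens (k *: a) v - k *: ptens a v)
| TensScaler k a v : tens_rel (ptens a (k *: v) - k *: ptens a v)
| TensBalance a (b : env P) v :
    tens_rel (ptens (a * env_map phi b) v - ptens a (env_act b v)).

Definition induced := lquot tens_rel.
HB.instance Definition _ := GRing.Lmodule.on induced.

Definition ipi (x : tens_free) : induced := lpi tens_rel x.
Definition irep (m : induced) : tens_free := lrep m.

Lemma ipi_linear : linear ipi. Proof. exact: lpi_is_linear. Qed.
HB.instance Definition _ :=
  GRing.isLinear.Build K tens_free induced *:%R ipi ipi_linear.

Lemma irepK : cancel irep ipi. Proof. exact: lrepK. Qed.

Definition tens (a : env L) (v : V) : induced := ipi (ptens a v).

Lemma tens_linearl v : linear (tens^~ v).
Proof.
move=> k a b; rewrite /tens -linearP; apply/lpiP.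
have := lspanD (lspan_gen (TensAddl (k *: a) b v)) (lspan_gen (TensScalel k a v)).
by rewrite subr_trans3.
Qed.

Lemma tens_linearr a : linear (tens a).
Proof.
move=> k u v; rewrite /tens -linearP; apply/lpiP.
have := lspanD (lspan_gen (TensAddr a (k *: u) v)) (lspan_gen (TensScaler k a u)).
by rewrite subr_trans3.
Qed.

Lemma tens_balance a b v : tens (a * env_map phi b) v = tens a (env_act b v).
Proof. by apply/lpiP; apply: lspan_gen; exact: TensBalance. Qed.

Definition free_mull (c : env L) : tens_free -> tens_free :=
  lext (fun av : env L * V => ptens (c * av.1) av.2).

Definition ind_mull : env L -> induced -> induced :=
  locked (fun c m => ipi (free_mull c (irep m))).

Lemma free_mull_linear c : linear (free_mull c). Proof. exact: linearP. Qed.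

Lemma free_mull_tens c a v : free_mull c (ptens a v) = ptens (c * a) v.
Proof. by rewrite [ptens a v]ptensE /free_mull lextU1. Qed.

Lemma free_mull_rel c r : lspan tens_rel r -> lspan tens_rel (free_mull c r).
Proof.
apply: lspan_linear; first exact: free_mull_linear.
have E := free_mull_tens c.
have lB u v : free_mull c (u - v) = free_mull c u - free_mull c v.
  by rewrite /free_mull linearB.
have lD u v : free_mull c (u + v) = free_mull c u + free_mull c v.
  by rewrite /free_mull linearD.
have lZ k v : free_mull c (k *: v) = k *: free_mull c v.
  by rewrite /free_mull linearZ.
move=> _ [a b v|a u v|k a v|k a v|a b v]; apply: lspan_gen.
- by rewrite lB lD !E mulrDr; apply: TensAddl.
- by rewrite lB lD !E; apply: TensAddr.
- by rewrite lB lZ !E -scalerAr; apply: TensScalel.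
- by rewrite lB lZ !E; apply: TensScaler.
by rewrite lB !E mulrA; apply: TensBalance.
Qed.

Lemma ind_mull_pi c x :
  ind_mull c (ipi x) = ipi (free_mull c x).
Proof.
rewrite /ind_mull -lock; apply/lpiP; have <- : free_mull c (irep (ipi x) - x) =
  free_mull c (irep (ipi x)) - free_mull c x by exact: linearB.
exact/free_mull_rel/lrep_lpi.
Qed.

Lemma ind_mullE c a v : ind_mull c (tens a v) = tens (c * a) v.
Proof. by rewrite ind_mull_pi free_mull_tens. Qed.

Lemma ind_mull_linearr c : linear (ind_mull c).
Proof.
move=> k m n; rewrite -[m]irepK -[n]irepK; move: (irep m) (irep n) => x y.
rewrite -(ipi_linear k x y). rewrite (ind_mull_pi c x) (ind_mull_pi c y).
rewrite (ind_mull_pi c (k *: x + y)) (free_mull_linear c k x y).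
exact: ipi_linear.
Qed.

Lemma eq_ind (W : lmodType K) (f g : induced -> W) :
  linear f -> linear g -> (forall a v, f (tens a v) = g (tens a v)) -> f =1 g.
Proof.
move=> fl gl fg m; rewrite -[m]irepK; move: (irep m) => x {m}.
apply: (@eq_linear_malg K _ W (fun x => f (ipi x))
   (fun x => g (ipi x))) => [k u v|k u v|[a v]].
- by rewrite linearP fl.
- by rewrite linearP gl.
by rewrite -ptensE fg.
Qed.

Lemma ind_mull_linearl m : linear (ind_mull^~ m).
Proof.
move=> k c d; move: m.
apply: eq_ind => [|l m n|a v]; first exact: ind_mull_linearr.
  rewrite !ind_mull_linearr !scalerDr !scalerA mulrC -!addrA; congr (_ + _).
  by rewrite addrCA.
by rewrite !ind_mullE mulrDl -scalerAl tens_linearl.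
Qed.

Lemma ind_mullA c d m : ind_mull (c * d) m = ind_mull c (ind_mull d m).
Proof.
move: m; apply: eq_ind => [|l m n|a v]; first exact: ind_mull_linearr.
  by rewrite !ind_mull_linearr.
by rewrite !ind_mullE mulrA.
Qed.

Definition ind_lact (x : L) (m : induced) : induced := ind_mull (env_in x) m.

Fact ind_lact_linearl m : linear (ind_lact^~ m).
Proof. by move=> k x y; rewrite /ind_lact env_in_linear ind_mull_linearl. Qed.

Fact ind_lact_linearr x : linear (ind_lact x).
Proof. exact: ind_mull_linearr. Qed.

Fact ind_lact_lie x y m :
  ind_lact [lie x, y] m = ind_lact x (ind_lact y m) - ind_lact y (ind_lact x m).
Proof.
rewrite /ind_lact env_in_lie -!ind_mullA.
by rewrite addrC -scaleN1r ind_mull_linearl scaleN1r addrC.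
Qed.

HB.instance Definition _ := Lmodule_isLieModule.Build K L induced
  ind_lact_linearl ind_lact_linearr ind_lact_lie.

Lemma lact_tens x a v : lact x (tens a v) = tens (env_in x * a) v.
Proof. exact: ind_mullE. Qed.

Lemma lact_tens1 (x : P) v :
  lie_hom phi -> lact (phi x) (tens 1 v) = tens 1 (lact x v).
Proof.
move=> phi_hom; rewrite lact_tens mulr1 -(env_map_in phi_hom) -env_act_in.
by rewrite -tens_balance mul1r.
Qed.

End Induced.

Lemma jacobi_cancel (V : zmodType) (a b c d e f : V) :
  (a - b) - (c - d) + ((c - e) - (f - b)) + ((f - d) - (a - e)) = 0.
Proof.
rewrite !opprB !addrA.
rewrite (ACl ((1*12)*(2*7)*(3*10)*(4*5)*(6*11)*(8*9))%AC) /=.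
by rewrite !(addrN, addNr) !addr0.
Qed.

Section GlInf.
Variable K : fieldType.

(* The (m, n) entry of x is x@_(m, n). *)
Definition gl_inf := {malg K[(int * int)%type]}.
HB.instance Definition _ := GRing.Lmodule.on gl_inf.

Definition E_ : int -> int -> gl_inf := locked (fun m n => << (m, n) >>).
Lemma E_E m n : E_ m n = << (m, n) >>. Proof. by rewrite /E_ -lock. Qed.

Lemma eq_gl (V : lmodType K) (f g : gl_inf -> V) :
  linear f -> linear g -> (forall m n, f (E_ m n) = g (E_ m n)) -> f =1 g.
Proof.
by move=> fl gl fg; apply: eq_linear_malg fl gl _ => -[m n]; rewrite -E_E.
Qed.

(* Bilinear extension of E_ m n * E_ r s = E_ m s if n = r, and 0 otherwise.  *)
Definition mxmul : gl_inf -> gl_inf -> gl_inf :=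
  locked (fun x y => lext (fun e : int * int =>
    lext (fun f : int * int => if e.2 == f.1 then E_ e.1 f.2 else 0) y) x).

Lemma mxmulE x y : mxmul x y = \sum_(e <- msupp x) x@_e *:
  \sum_(f <- msupp y) y@_f *: (if e.2 == f.1 then E_ e.1 f.2 else 0).
Proof. by rewrite /mxmul -lock. Qed.

Lemma mxmul_linearl y : linear (mxmul^~ y).
Proof. by move=> k x x'; rewrite /mxmul -lock linearP. Qed.

Lemma mxmul_linearr x : linear (mxmul x).
Proof.
move=> k y y'; rewrite /mxmul -lock -lextZf -lextDf.
by apply: eq_lext => e; rewrite linearP.
Qed.

Lemma mxmulEE m n r s : mxmul (E_ m n) (E_ r s) = if n == r then E_ m s else 0.
Proof. by rewrite !E_E /mxmul -lock !lextU1 -E_E. Qed.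

Lemma mxmul0l y : mxmul 0 y = 0.
Proof.
by have := mxmul_linearl y (-1) 0 0; rewrite scaler0 addr0 scaleN1r addNr.
Qed.
Lemma mxmul0r x : mxmul x 0 = 0.
Proof.
by have := mxmul_linearr x (-1) 0 0; rewrite scaler0 addr0 scaleN1r addNr.
Qed.
Lemma mxmulBl x x' y : mxmul (x - x') y = mxmul x y - mxmul x' y.
Proof. by rewrite addrC -scaleN1r mxmul_linearl scaleN1r addrC. Qed.
Lemma mxmulBr x y y' : mxmul x (y - y') = mxmul x y - mxmul x y'.
Proof. by rewrite addrC -scaleN1r mxmul_linearr scaleN1r addrC. Qed.

Lemma mxmulA x y z : mxmul x (mxmul y z) = mxmul (mxmul x y) z.
Proof.
move: x; apply: eq_gl => [k u v|k u v|m n]; rewrite ?mxmul_linearl //.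
move: y; apply: eq_gl => [k u v|k u v|r s];
  rewrite ?mxmul_linearl ?mxmul_linearr ?mxmul_linearl //.
move: z; apply: eq_gl => [k u v|k u v|p q]; rewrite ?mxmul_linearr //.
rewrite !mxmulEE; case nr: (n == r); case sp: (s == p);
  by rewrite ?mxmul0l ?mxmul0r ?mxmulEE ?nr ?sp.
Qed.

Definition gl_bracket (x y : gl_inf) : gl_inf := mxmul x y - mxmul y x.

Lemma gl_bracketE m n r s : gl_bracket (E_ m n) (E_ r s) =
  (if n == r then E_ m s else 0) - (if m == s then E_ r n else 0).
Proof. by rewrite /gl_bracket !mxmulEE (eq_sym s m). Qed.

Fact gl_bracket_linearl y : linear (gl_bracket^~ y).
Proof.
move=> k x x'; rewrite /gl_bracket mxmul_linearl mxmul_linearr.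
by rewrite opprD addrACA scalerBr.
Qed.

Fact gl_bracket_linearr x : linear (gl_bracket x).
Proof.
move=> k y y'; rewrite /gl_bracket mxmul_linearl mxmul_linearr.
by rewrite opprD addrACA scalerBr.
Qed.

Fact gl_bracket_alternating x : gl_bracket x x = 0.
Proof. exact: subrr. Qed.

Fact gl_jacobi x y z :
  gl_bracket x (gl_bracket y z) + gl_bracket y (gl_bracket z x)
  + gl_bracket z (gl_bracket x y) = 0.
Proof.
by rewrite /gl_bracket !(mxmulBr, mxmulBl) !mxmulA; apply: jacobi_cancel.
Qed.

HB.instance Definition _ := Lmodule_isLieAlgebra.Build K gl_inf
  gl_bracket_linearl gl_bracket_linearr gl_bracket_alternating gl_jacobi.

End GlInf.

Record trel := TRel { trel_rel :> rel int; trelP : transitive trel_rel }.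

Section GlSub.
Variables (K : fieldType) (D : trel).

(* The span of the E_ m n with D m n; transitivity of D makes it a subalgebra. *)
Definition glsub_pred : {pred gl_inf K} :=
  fun x => all (fun e : int * int => D e.1 e.2) (msupp x).

Record glsub := GlSub { glsub_val : gl_inf K; _ : glsub_pred glsub_val }.

HB.instance Definition _ := [isSub for glsub_val].
HB.instance Definition _ := [Choice of glsub by <:].

Lemma glsub_predP (x : gl_inf K) :
  reflect (forall m n, x@_(m, n) != 0 -> D m n) (x \in glsub_pred).
Proof.
apply: (iffP allP) => [xD m n|xD [m n]].
  by rewrite mcoeff_neq0 => /xD.
by rewrite -mcoeff_neq0 => /xD.
Qed.

Fact glsub_submod_closed : submod_closed glsub_pred.
Proof.
split=> [|a x y /glsub_predP xD /glsub_predP yD]; apply/glsub_predP => m n.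
  by rewrite mcoeff0 eqxx.
rewrite mcoeffD mcoeffZ; have [x0|/xD //] := eqVneq (x@_(m, n)) 0.
by rewrite x0 mulr0 add0r => /yD.
Qed.

HB.instance Definition _ :=
  GRing.isSubmodClosed.Build K (gl_inf K) glsub_pred glsub_submod_closed.
HB.instance Definition _ := [SubChoice_isSubLmodule of glsub by <:].

Lemma E_in m n : (E_ K m n \in glsub_pred) = D m n.
Proof.
apply/glsub_predP/idP => [|Dmn r s]; first by apply; rewrite E_E mcoeffUU oner_eq0.
by rewrite E_E mcoeffU; case: ((m, n) =P (r, s)) => [[<- <-] //|_]; rewrite eqxx.
Qed.

Lemma glsub_mxmul x y :
  x \in glsub_pred -> y \in glsub_pred -> mxmul x y \in glsub_pred.
Proof.
move=> /allP xD /allP yD; rewrite mxmulE big_seq.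
apply: rpred_sum => e /xD De; apply: rpredZ; rewrite big_seq.
apply: rpred_sum => f /yD Df; apply: rpredZ; case: eqP => [ef|_].
  by rewrite E_in (trelP (y := e.2)) // ef.
exact: rpred0.
Qed.

Fact glsub_bracket_closed (x y : glsub) : [lie val x, val y] \in glsub_pred.
Proof. by apply: rpredB; apply: glsub_mxmul; apply: valP. Qed.

Definition glsub_bracket (x y : glsub) : glsub := GlSub (glsub_bracket_closed x y).

Lemma val_bracket x y : val (glsub_bracket x y) = [lie val x, val y].
Proof. by []. Qed.

Lemma glval_linear : linear (val : glsub -> gl_inf K).
Proof. exact: (linearP (val : {linear glsub -> gl_inf K})). Qed.

Fact glsub_bracket_linearl y : linear (glsub_bracket^~ y).
Proof.
move=> k x x'; apply: val_inj.
by rewrite glval_linear !val_bracket glval_linear lie_linearl.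
Qed.
Fact glsub_bracket_linearr x : linear (glsub_bracket x).
Proof.
move=> k y y'; apply: val_inj.
by rewrite glval_linear !val_bracket glval_linear lie_linearr.
Qed.
Fact glsub_bracket_alternating x : glsub_bracket x x = 0.
Proof. by apply: val_inj; rewrite val_bracket lie_alternating raddf0. Qed.
Fact glsub_jacobi x y z :
  glsub_bracket x (glsub_bracket y z) + glsub_bracket y (glsub_bracket z x)
  + glsub_bracket z (glsub_bracket x y) = 0.
Proof. by apply: val_inj; rewrite !raddfD raddf0 -[RHS](lie_jacobi (val x) (val y) (val z)). Qed.

HB.instance Definition _ := Lmodule_isLieAlgebra.Build K glsub
  glsub_bracket_linearl glsub_bracket_linearr glsub_bracket_alternating
  glsub_jacobi.

(* E_ m n as an element of the subspace, 0 unless D m n. *)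
Definition subE (m n : int) : glsub := insubd 0 (E_ K m n).

Lemma val_subE m n : val (subE m n) = if D m n then E_ K m n else 0.
Proof. by rewrite val_insubd -[glsub_pred _]/(_ \in glsub_pred) E_in. Qed.

(* Replacing by 0 the entries of x at the positions outside D. *)
Definition glres : gl_inf K -> glsub := lext (fun e : int * int => subE e.1 e.2).

Lemma glres_linear : linear glres. Proof. exact: linearP. Qed.
Lemma glresE m n : glres (E_ K m n) = subE m n.
Proof. by rewrite E_E /glres lextU1. Qed.

End GlSub.

Section Subalgebras.
Variable S : {fset int}.

Fact diag_trans : transitive (fun m n : int => m == n).
Proof. by move=> y x z /eqP-> /eqP->. Qed.
Definition diag_rel := TRel diag_trans.

Fact square_trans : transitive (fun m n : int => (m \in S) && (n \in S)).
Proof. by move=> y x z /andP[-> _] /andP[_ ->]. Qed.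
Definition square_rel := TRel square_trans.

Fact plus_trans : transitive (fun m n : int => n \notin S).
Proof. by []. Qed.
Definition plus_rel := TRel plus_trans.

Fact par_trans : transitive (fun m n : int => plus_rel m n || square_rel m n).
Proof.
move=> y x z /=; case: (z \in S) => //=; rewrite !andbT.
by case: (y \in S) => //=; rewrite andbT.
Qed.
Definition par_rel := TRel par_trans.

End Subalgebras.

Section Modules.
Variable K : fieldType.

Definition cartan := glsub K diag_rel.
HB.instance Definition _ := LieAlgebra.on cartan.
Definition EH (n : int) : cartan := subE K diag_rel n n.

Variable S : {fset int}.

Definition gl_S := glsub K (square_rel S).
HB.instance Definition _ := LieAlgebra.on gl_S.
Definition ES (m n : int) : gl_S := subE K (square_rel S) m n.

(* plus_rel S spans gl_infty^(S,+) and square_rel S spans gl_S, so par_rel S *)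
(* spans their sum. *)
Definition gl_par := glsub K (par_rel S).
HB.instance Definition _ := LieAlgebra.on gl_par.

Definition par_incl (x : gl_par) : gl_inf K := val x.

Lemma par_incl_hom : lie_hom par_incl.
Proof. by split=> [k x y|x y]; rewrite /par_incl ?linearP. Qed.

Definition par_proj (x : gl_par) : gl_S := glres (square_rel S) (val x).

Fact par_proj_linear : linear par_proj.
Proof. by move=> k x y; rewrite /par_proj linearP glres_linear. Qed.

Fact par_proj_lie x y : par_proj [lie x, y] = [lie par_proj x, par_proj y].
Proof.
pose p (z : gl_inf K) : gl_inf K := val (glres (square_rel S) z).
have pZ k u : p (k *: u) = k *: p u.
  have := glres_linear (square_rel S) k u 0; rewrite addr0 /p => ->.
  by rewrite /glres linear0 addr0 linearZ.
have pD u v : p (u + v) = p u + p v.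
  have := glres_linear (square_rel S) 1 u v; rewrite scale1r /p => ->.
  by rewrite linearP /= scale1r.
have p0 : p 0 = 0 by rewrite /p /glres !linear0.
have pE m n : p (E_ K m n) = if (m \in S) && (n \in S) then E_ K m n else 0.
  by rewrite /p glresE val_subE.
have psum (I : choiceType) (r : seq I) (F : I -> gl_inf K) :
  p (\sum_(i <- r) F i) = \sum_(i <- r) p (F i) by apply: big_morph.
have pM (u v : gl_inf K) : u \in glsub_pred (par_rel S) ->
    v \in glsub_pred (par_rel S) -> p (mxmul u v) = mxmul (p u) (p v).
  move=> /allP uD /allP vD.
  have pl w : p w = \sum_(e <- msupp w) w@_e *: p (E_ K e.1 e.2).
    by rewrite {1}[w]malg_eq_lext psum; apply: eq_bigr => -[m n] _; rewrite pZ E_E.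
  have ml w F (r : {fset int * int}) c :
      mxmul (\sum_(e <- r) c e *: F e) w = \sum_(e <- r) c e *: mxmul (F e) w.
    apply: (big_ind2 (fun a b => mxmul a w = b)); first exact: mxmul0l.
      by move=> a a' b b' <- <-; have := mxmul_linearl w 1 a b; rewrite !scale1r.
    by move=> e _; rewrite -[c e *: F e]addr0 mxmul_linearl mxmul0l addr0.
  have mr w F (r : {fset int * int}) c :
      mxmul w (\sum_(e <- r) c e *: F e) = \sum_(e <- r) c e *: mxmul w (F e).
    apply: (big_ind2 (fun a b => mxmul w a = b)); first exact: mxmul0r.
      by move=> a a' b b' <- <-; have := mxmul_linearr w 1 a b; rewrite !scale1r.
    by move=> e _; rewrite -[c e *: F e]addr0 mxmul_linearr mxmul0r addr0.
  rewrite (pl u) (pl v) ml mxmulE psum.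
  rewrite big_seq [RHS]big_seq; apply: eq_bigr => -[m n] /uD /= Dmn.
  rewrite pZ mr psum; congr (_ *: _).
  rewrite big_seq [RHS]big_seq; apply: eq_bigr => -[r s] /vD /= Drs.
  rewrite pZ; congr (_ *: _); rewrite /= !pE; move: Dmn Drs => /=.
  have [<-|nr] := eqVneq n r; first rewrite pE.
    case: (m \in S); case: (n \in S); case: (s \in S) => //=;
    by rewrite ?mxmulEE ?eqxx ?mxmul0l ?mxmul0r.
  rewrite p0; case: ifP => _; case: ifP => _;
  by rewrite ?mxmulEE ?(negPf nr) ?mxmul0l ?mxmul0r.
apply: val_inj; rewrite -[LHS]/(p (mxmul (val x) (val y) - mxmul (val y) (val x))).
rewrite -scaleN1r pD pZ scaleN1r !pM //; by [exact: valP].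
Qed.

Lemma par_proj_hom : lie_hom par_proj.
Proof. by split; [exact: par_proj_linear | exact: par_proj_lie]. Qed.

(* gl_infty^(S,+) is killed by par_proj, hence acts trivially on infl. *)
Section Inflation.
Variable U : lieModType gl_S.

Definition infl : Type := U.
HB.instance Definition _ := GRing.Lmodule.on infl.

Definition infl_lact (x : gl_par) (u : infl) : infl := lact (par_proj x) (u : U).

Fact infl_linearl u : linear (infl_lact^~ u).
Proof. by move=> k x y; rewrite /infl_lact par_proj_linear lact_linearl. Qed.
Fact infl_linearr x : linear (infl_lact x).
Proof. by move=> k u v; rewrite /infl_lact lact_linearr. Qed.
Fact infl_lie x y u : infl_lact [lie x, y] u =
  infl_lact x (infl_lact y u) - infl_lact y (infl_lact x u).
Proof. by rewrite /infl_lact par_proj_lie lact_lie. Qed.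

HB.instance Definition _ := Lmodule_isLieModule.Build K gl_par infl
  infl_linearl infl_linearr infl_lie.

Definition M_SU := induced par_incl infl.
HB.instance Definition _ := LieModule.on M_SU.

End Inflation.

Definition integrable (V : lieModType (gl_inf K)) :=
  (forall n : int, acts_semisimply (fun v : V => lact (E_ K n n) v)) /\
  (forall p q : int, p != q -> locally_nilpotent (fun v : V => lact (E_ K p q) v)).

Variable lam : {scalar cartan}.

Definition supp : pred int := fun m => lam (EH m) != 0.

(* lam_S enters only through its values on the basis E_{n,n}, n in S, of H_S. *)
Definition highest_weight_vector (U : lieModType gl_S) (v : U) :=
  [/\ v != 0,
      forall m n : int, m \in S -> n \in S -> m < n -> lact (ES m n) v = 0
    & forall n : int, n \in S -> lact (ES n n) v = lam (EH n) *: v].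

(* L(lam_S) and L(S, lam) are determined up to isomorphism; these predicates *)
(* say that a module is a copy of them. *)
Definition is_L_lamS (U : lieModType gl_S) :=
  irreducible U /\ exists2 v : U, highest_weight_vector v & generated_by v.

Definition is_L_Slam (V : lieModType (gl_inf K)) :=
  exists2 U : lieModType gl_S, is_L_lamS U & irreducible_quotient (M_SU U) V.

End Modules.

Definition P_plus (K : numFieldType) (S : {fset int}) (lam : {scalar cartan K}) :=
  [/\ forall i, exists k : nat, lam (EH K i) = k%:R,
      forall i, i \notin S -> lam (EH K i) = 0
    & forall i j, i \in S -> j \in S -> i < j -> lam (EH K j) <= lam (EH K i)].

(* Main.v *)
Require Import Defs.
From HB Require Import structures.
From mathcomp Require Import all_boot all_order all_algebra.
From mathcomp Require Import finmap boolp reals complex.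
From mathcomp Require Import monalg ring zify.

Set Implicit Arguments.
Unset Strict Implicit.
Unset Printing Implicit Defensive.

Import Order.TTheory GRing.Theory Num.Theory.

Local Open Scope ring_scope.

(* Both conditions of integrability hold on a submodule (E_{p,q} is           *)
(* ad-nilpotent for p <> q), so on the irreducible L each of them need only be *)
(* checked on one nonzero vector.  The image w of the highest weight vector of *)
(* L(lam_S) is a highest weight vector for every order on Z listing S          *)
(* increasingly and then the rest.  If L is integrable, sl_2-theory for        *)
(* (E_{i,j}, E_{j,i}) applied to w shows that lam_i - lam_j is in N, for i < j *)
(* in S, and also for i in S, j not in S, where lam_j = 0.  Conversely, if     *)
(* a, b are adjacent in the order and k = lam_a - lam_b is in N, then          *)
(* E_{b,a}^{k+1} w is singular, hence zero, and E_{b,a}^k w is a highest       *)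
(* weight vector for the order with a and b exchanged.  Such exchanges bring   *)
(* any two indices next to each other, so every E_{p,q} is nilpotent on some   *)
(* nonzero vector.                                                            *)

(** Necessity is [sl2_integral]: if a lowering operator is nilpotent on a weight vector killed by
    the raising one, the weight difference is a natural number. For sufficiency, a singular vector
    of degree below that of the highest weight vector generates only lower degrees, so it vanishes
    in an irreducible module ([singular_eq0]). Along the [sl_2]-string of an adjacent pair this
    gives [adjacent_nilpotent] and [highest_weight_swap], which [nilpotent_vector] iterates.
    [exists_highest_weight_vector] supplies the starting vector, and [irreducible_full] spreads both
    integrability conditions from one vector to the module. *)

Section LieModuleTheory.
Variables (K : fieldType) (L : lieAlgType K) (V : lieModType L).
Implicit Types (x y : L) (u v w : V) (W : V -> Prop).

HB.instance Definition _ x :=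
  GRing.isLinear.Build K V V *:%R (lact x) (lact_linearr x).

Definition lactl v x : V := lact x v.
HB.instance Definition _ v :=
  GRing.isLinear.Build K L V *:%R (lactl v) (lact_linearl v).

Lemma lact0 x : lact x (0 : V) = 0. Proof. exact: linear0. Qed.
Lemma lactD x u v : lact x (u + v) = lact x u + lact x v.
Proof. exact: linearD. Qed.
Lemma lactB x u v : lact x (u - v) = lact x u - lact x v.
Proof. exact: linearB. Qed.
Lemma lactZ x a v : lact x (a *: v) = a *: lact x v.
Proof. exact: linearZ. Qed.
Lemma lact0l v : lact 0 v = 0.
Proof. exact: (linear0 (lactl v)). Qed.
Lemma lactZl a x v : lact (a *: x) v = a *: lact x v.
Proof. by rewrite -[a *: x]addr0 lact_linearl lact0l addr0. Qed.

Lemma lactC x y v : lact x (lact y v) = lact y (lact x v) + lact [lie x, y] v.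
Proof. by rewrite lact_lie addrC subrK. Qed.

Lemma irreducible_full W w :
  irreducible V -> submodule W -> W w -> w != 0 -> forall v, W v.
Proof. by case=> _ irr /irr[W0 /W0->|//]; rewrite eqxx. Qed.

Lemma iter_lactP N x k u v :
  iter N (lact x) (k *: u + v) = k *: iter N (lact x) u + iter N (lact x) v.
Proof. by elim: N => //= N ->; rewrite linearP. Qed.

Lemma iter_lactD N x u v :
  iter N (lact x) (u + v) = iter N (lact x) u + iter N (lact x) v.
Proof. by have := iter_lactP N x 1 u v; rewrite !scale1r. Qed.

Lemma iter_lact0 N x : iter N (lact x) (0 : V) = 0.
Proof. by elim: N => //= N ->; rewrite lact0. Qed.

Lemma iter_lact_ge N M x v :
  (N <= M)%N -> iter N (lact x) v = 0 -> iter M (lact x) v = 0.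
Proof. by move=> /subnK<- xv; rewrite iterD xv iter_lact0. Qed.

(** By the Leibniz rule [lactC], each application of [x] either uses up a power on [v] or one more
    bracket on [y]; hence the double induction. *)
Lemma iter_lact_lact N j x y v :
    iter j (lie_bracket x) y = 0 -> iter N (lact x) v = 0 ->
  iter (N + j) (lact x) (lact y v) = 0.
Proof.
elim: j N y v => [|j IHj] N y v.
  by move=> /= -> _; rewrite lact0l iter_lact0.
move=> xy; elim: N v => [|N IHN] v xv.
  by rewrite (xv : v = 0) lact0 iter_lact0.
rewrite addSn iterSr lactC iter_lactD IHN -?iterSr // add0r -addSnnS.
by apply: IHj; rewrite -?iterSr.
Qed.

Lemma submodule_nilpotent x : (forall y, exists j, iter j (lie_bracket x) y = 0) ->
  submodule (fun v => exists N, iter N (lact x) v = 0).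
Proof.
move=> ad_nil; split=> [|a u v [N xu] [M xv]|y v [N xv]]; first by exists 0.
  exists (maxn N M); rewrite iter_lactP (iter_lact_ge (leq_maxl N M)) //.
  by rewrite (iter_lact_ge (leq_maxr N M)) // scaler0 addr0.
by have [j xy] := ad_nil y; exists (N + j)%N; apply: iter_lact_lact.
Qed.

(* Eigenvectors for distinct eigenvalues are independent: the product of the *)
(* [T - b] over the eigenvalues [b != c] annihilates [w] but scales it by a  *)
(* nonzero factor.                                                           *)
Lemma eigen_lspan0 x c w : lact x w = c *: w ->
  lspan (fun v => exists2 b, b != c & lact x v = b *: v) w -> w = 0.
Proof.
move=> xw sw; pose T s v := foldr (fun b v => lact x v - b *: v) v s.
have Tlin s : linear (T s).
  move=> k u v; elim: s => //= b s ->.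
  rewrite linearP /= !scalerDr scalerN !scalerA.
  by rewrite (mulrC k) opprD addrACA.
have T0 s : T s 0 = 0.
  by have := Tlin s (-1) 0 0; rewrite scaler0 addr0 scaleN1r addNr.
have TZ s k v : T s (k *: v) = k *: T s v by rewrite -[k *: v]addr0 Tlin T0 addr0.
have Tx s v : T s (lact x v) = lact x (T s v).
  elim: s => [|b s IH] //=; rewrite -/(T s v) -/(T s (lact x v)) IH.
  by rewrite lactB lactZ.
have [s sc Tw] : exists2 s, c \notin s & T s w = 0.
  elim: sw => [|a u v [b bc xu] _ [s sc Tv]]; first by exists [::].
  exists (b :: s); first by rewrite inE negb_or eq_sym bc.
  rewrite Tlin -/(T s v) (_ : T (b :: s) u = 0).
    by rewrite scaler0 add0r /= Tv lact0 scaler0 subrr.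
  by rewrite /= -/(T s u) -Tx xu TZ subrr.
have [//|w0] := eqVneq w 0.
elim: s sc Tw => [|b s IH] //=; rewrite inE negb_or => /andP[cb cs].
rewrite -Tx xw TZ -scalerBl => /eqP; rewrite scaler_eq0 subr_eq0 (negPf cb) /=.
by move/eqP/(IH cs).
Qed.

End LieModuleTheory.

(** * Submodules that witness integrability *)

Section GlInfModules.
Variables (K : fieldType) (V : lieModType (gl_inf K)).
Implicit Types (m n : int) (u v w : V) (W : V -> Prop).

Local Notation E := (E_ K).

Lemma lactEE m n r s v : lact (E m n) (lact (E r s) v) =
  lact (E r s) (lact (E m n) v) +
  ((if n == r then lact (E m s) v else 0) -
   (if m == s then lact (E r n) v else 0)).
Proof.
rewrite lactC; congr (_ + _).
have -> : [lie E m n, E r s] = (if n == r then E m s else 0) -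
    (if m == s then E r n else 0) by exact: gl_bracketE.
rewrite -/(lactl v _) linearB.
by case: eqP => _; case: eqP => _; rewrite ?linear0.
Qed.

Lemma submoduleE W : W 0 -> (forall a u v, W u -> W v -> W (a *: u + v)) ->
  (forall m n v, W v -> W (lact (E m n) v)) -> submodule W.
Proof.
move=> W0 WD WE; split=> // x v Wv.
rewrite [lact x v](linear_malg (lact_linearl v)) /lext.
elim/big_rec: _ => // -[m n] u _ Wu; apply: WD => //.
by rewrite -E_E; apply: WE.
Qed.

(** Since [x * x = 0], the double bracket leaves only a multiple of [x * y * x], which the third
    bracket kills. *)
Lemma iter_ad_E p q (y : gl_inf K) :
  p != q -> iter 3 (lie_bracket (E p q)) y = 0.
Proof.
move=> pq; set x := E p q.
have xx : mxmul x x = 0 by rewrite mxmulEE eq_sym (negPf pq).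
have mxx z : mxmul (mxmul z x) x = 0 by rewrite -mxmulA xx mxmul0r.
rewrite /= -![lie_bracket _ _]/(gl_bracket _ _) /gl_bracket.
by rewrite !(mxmulBl, mxmulBr) !mxmulA !(xx, mxx, mxmul0l) !(subr0, sub0r, oppr0).
Qed.

Lemma submodule_E_nilpotent p q : p != q ->
  submodule (fun v : V => exists N, iter N (lact (E p q)) v = 0).
Proof.
by move=> pq; apply: submodule_nilpotent => y; exists 3; apply: iter_ad_E.
Qed.

(** Each matrix unit is an eigenvector of [ad (E n n)], so it maps eigenvectors of [E n n] to
    eigenvectors, with a shifted eigenvalue. *)
Lemma submodule_E_semisimple n :
  submodule (lspan (fun v : V => exists c, lact (E n n) v = c *: v)).
Proof.
apply: submoduleE => [|a u v Wu Wv|r s]; first by constructor.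
  by apply: lspanD => //; apply: lspanZ.
apply: lspan_linear => [|v [c nv]]; first exact: lact_linearr.
apply: lspan_gen; exists (c + ((n == r)%:R - (n == s)%:R)).
rewrite lactEE nv lactZ scalerDl scalerBl; congr (_ + (_ - _)).
  by case: eqP => [<-|_]; rewrite ?scale1r ?scale0r.
by case: eqP => [<-|_]; rewrite ?scale1r ?scale0r.
Qed.

Lemma lspan_seq (G : V -> Prop) v : (forall a u, G u -> G (a *: u)) ->
  lspan G v -> exists2 s : seq V, (forall w, w \in s -> G w) & v = \sum_(w <- s) w.
Proof.
move=> GZ; elim=> [|a r u Gr _ [s sG ->]]; first by exists [::]; rewrite ?big_nil.
exists (a *: r :: s); last by rewrite big_cons.
by move=> w; rewrite inE => /predU1P[->|/sG//]; apply: GZ.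
Qed.

End GlInfModules.

(** * The [sl_2]-string through a weight vector *)

Section Sl2.
Variables (K : fieldType) (V : lieModType (gl_inf K)).
Implicit Types (m n : int) (u v w : V) (mu : int -> K).

Local Notation E := (E_ K).

Definition weight_vector mu v := forall n, lact (E n n) v = mu n *: v.

Lemma lactE_diag n r s v : lact (E n n) (lact (E r s) v) =
  lact (E r s) (lact (E n n) v) + ((n == r)%:R - (n == s)%:R) *: lact (E r s) v.
Proof.
rewrite lactEE scalerBl; congr (_ + (_ - _)).
  by case: eqP => [<-|_]; rewrite ?scale1r ?scale0r.
by case: eqP => [<-|_]; rewrite ?scale1r ?scale0r.
Qed.

Lemma weight_vector_iter mu v r s j : weight_vector mu v ->
  weight_vector (fun n => mu n + j%:R * ((n == r)%:R - (n == s)%:R))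
    (iter j (lact (E r s)) v).
Proof.
move=> wv n; elim: j => [|j IH] /=; first by rewrite mul0r addr0.
by rewrite lactE_diag IH lactZ -scalerDl -[j.+1]addn1 natrD; congr (_ *: _); ring.
Qed.

Lemma sl2_raise mu w a b j : a != b -> lact (E a b) w = 0 -> weight_vector mu w ->
  lact (E a b) (iter j (lact (E b a)) w) =
    (j%:R * (mu a - mu b - j%:R + 1)) *: iter j.-1 (lact (E b a)) w.
Proof.
move=> ab w0 ww; elim: j => [|j IH]; first by rewrite w0 mul0r scale0r.
rewrite iterS lactEE !eqxx IH !(weight_vector_iter _ _ _ ww) -scalerBl lactZ.
rewrite (negPf ab) eq_sym (negPf ab) !eqxx.
(* At [j = 0] the truncated predecessor is wrong, but the coefficient vanishes. *)
have -> : (j%:R * (mu a - mu b - j%:R + 1)) *: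
    lact (E b a) (iter j.-1 (lact (E b a)) w) =
    (j%:R * (mu a - mu b - j%:R + 1)) *: iter j (lact (E b a)) w.
  by case: j {IH} => [|j] //; rewrite mul0r !scale0r.
rewrite -scalerDl /=; congr (_ *: _); rewrite -[j.+1]addn1 natrD; ring.
Qed.

End Sl2.

(** * Highest weight vectors, the grading and singular vectors *)

Section HighestWeight.
Variables (K : numFieldType) (V : lieModType (gl_inf K)).
Implicit Types (m n a b : int) (u v w : V) (mu : int -> K) (T : seq int).

Local Notation E := (E_ K).

Lemma sl2_integral mu w a b N : a != b -> w != 0 -> lact (E a b) w = 0 ->
  weight_vector mu w -> iter N (lact (E b a)) w = 0 ->
  exists k : nat, mu a - mu b = k%:R.
Proof.
move=> ab w0 ew ww; elim: N => [/= /eqP|N IH fN]; first by rewrite (negPf w0).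
have := sl2_raise N.+1 ab ew ww; rewrite fN lact0 => /esym/eqP.
rewrite scaler_eq0 => /orP[|/eqP//]; rewrite mulf_eq0 pnatr_eq0 /= => /eqP muab.
exists N; apply/eqP; rewrite -subr_eq0 -[X in _ == X]muab -[N.+1]addn1 natrD.
by apply/eqP; ring.
Qed.

(** Raising the [j]-th vector returns the previous one times [j * (k - j + 1)], which is nonzero for
    [0 < j <= k] in characteristic zero. *)
Lemma sl2_string_neq0 mu w a b k j : a != b -> w != 0 -> lact (E a b) w = 0 ->
    weight_vector mu w -> mu a - mu b = k%:R ->
  (j <= k)%N -> iter j (lact (E b a)) w != 0.
Proof.
move=> ab w0 ew ww muab; elim: j => // j IH jk; apply/eqP => fj.
have := sl2_raise j.+1 ab ew ww; rewrite fj lact0 => /esym/eqP.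
rewrite scaler_eq0 (negPf (IH (ltnW jk))) orbF mulf_eq0 pnatr_eq0 /= muab.
rewrite -natrB // -[1]/(1%:R) -natrD pnatr_eq0; lia.
Qed.

Definition annihilated T v :=
  forall m n, m != n -> (index m T <= index n T)%N -> lact (E m n) v = 0.

(* The positive pairs [(m, n)], those with [m] before [n], come from a total *)
(* preorder in which the integers outside [T] are equivalent and last: the   *)
(* Levi part on those integers kills the vector too.                         *)
Definition highest_weight T mu v :=
  [/\ v != 0, annihilated T v & weight_vector mu v].

Definition height T n : nat := size T - index n T.

(** The bracket with this element scales [E m n] by the height difference of [m] and [n]; heights
    vanish off [T], so a finite sum suffices. *)
Definition grading T : gl_inf K := \sum_(t <- T) (height T t)%:R *: E t t.

Lemma lact_grading T v :
  lact (grading T) v = \sum_(t <- T) (height T t)%:R *: lact (E t t) v.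
Proof.
rewrite -[LHS]/(lactl v _) linear_sum; apply: eq_bigr => t _.
exact: lactZl.
Qed.

Lemma sum_height T m : uniq T ->
  \sum_(t <- T) (height T t)%:R * (t == m)%:R = (height T m)%:R :> K.
Proof.
move=> Tu; have [mT|mT] := boolP (m \in T).
  rewrite (bigD1_seq m) //= eqxx mulr1 big1 ?addr0 // => t /negPf->.
  by rewrite mulr0.
rewrite /height (memNindex mT) subnn big1_seq // => t /andP[_ tT].
by case: eqP mT => [<-|]; rewrite ?tT ?mulr0.
Qed.

Lemma lact_gradingE T m n v : uniq T -> lact (grading T) (lact (E m n) v) =
  lact (E m n) (lact (grading T) v) +
  ((height T m)%:R - (height T n)%:R) *: lact (E m n) v.
Proof.
move=> Tu; rewrite !lact_grading -(sum_height m Tu) -(sum_height n Tu).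
rewrite -[lact (E m n) (\sum_(_ <- _) _)]/((lact (E m n) : {linear V -> V}) _).
rewrite linear_sum -sumrB scaler_suml -big_split; apply: eq_bigr => t _ /=.
by rewrite lactE_diag scalerDr lactZ scalerA mulrBr.
Qed.

Lemma grading_weight T mu v : weight_vector mu v ->
  exists d, lact (grading T) v = d *: v.
Proof.
move=> wv; exists (\sum_(t <- T) (height T t)%:R * mu t).
by rewrite lact_grading scaler_suml; apply: eq_bigr => t _; rewrite wv scalerA.
Qed.

(* U(n-)u, where n- is spanned by the [E m n] with [n] before [m]. *)
Inductive lowered T u : V -> Prop :=
| Lowered0 : lowered T u 0
| LoweredG : lowered T u u
| LoweredP (c : K) v1 v2 : lowered T u v1 -> lowered T u v2 ->
    lowered T u (c *: v1 + v2)
| LoweredE m n v : (index n T < index m T)%N -> lowered T u v ->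
    lowered T u (lact (E m n) v).

(** Any matrix unit can be commuted past the lowering operators: the brackets are matrix units
    acting on shorter words, so the induction is uniform in [m] and [n]. *)
Lemma submodule_lowered T mu u :
  annihilated T u -> weight_vector mu u -> submodule (lowered T u).
Proof.
move=> au wu; apply: submoduleE; [exact: Lowered0 | exact: LoweredP |].
have lD v1 v2 : lowered T u v1 -> lowered T u v2 -> lowered T u (v1 + v2).
  by move=> l1 l2; rewrite -[v1]scale1r; apply: LoweredP.
have lZ c v : lowered T u v -> lowered T u (c *: v).
  by move=> l1; rewrite -[c *: v]addr0; apply: LoweredP => //; apply: Lowered0.
move=> m n v lv; elim: lv m n => {v} [||a v1 v2 _ IH1 _ IH2|r s v rs lv IH] m n.
- by rewrite lact0; apply: Lowered0.
- have [<-|mn] := eqVneq m n; first by rewrite wu; apply/lZ/LoweredG.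
  have [le_mn|] := leqP (index m T) (index n T); last first.
    by move=> lt_nm; apply/LoweredE/LoweredG.
  by rewrite au //; apply: Lowered0.
- by rewrite lactD lactZ; apply: LoweredP; [apply: IH1|apply: IH2].
rewrite lactEE; apply: (lD); first by apply: LoweredE.
apply: (lD); first by case: ifP => _; [apply: IH|apply: Lowered0].
by rewrite -scaleN1r; apply: (lZ); case: ifP => _; [apply: IH|apply: Lowered0].
Qed.

(** If [u] were nonzero, [w] would lie in the submodule obtained by lowering [u], which lives in
    degrees [d - j] with [j > 0]; but [w] has degree [d]. *)
Lemma singular_eq0 T mu nu w u d k : irreducible V -> uniq T ->
    highest_weight T mu w -> annihilated T u -> weight_vector nu u ->
    lact (grading T) w = d *: w -> lact (grading T) u = (d - k.+1%:R) *: u ->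
  u = 0.
Proof.
move=> irrV Tu [w0 _ _] au wu dw du; have [//|u0] := eqVneq u 0.
have lw := irreducible_full irrV (submodule_lowered au wu) (LoweredG T u) u0 w.
suff /(eigen_lspan0 dw) : lspan (fun v => exists2 b, b != d &
    lact (grading T) v = b *: v) w by move/eqP; rewrite (negPf w0).
apply: (lspan_linear (f := id)
  (G := fun v => exists k, lact (grading T) v = (d - k.+1%:R) *: v)) => //.
  move=> v [j dv]; apply: lspan_gen; exists (d - j.+1%:R) => //.
  by rewrite -subr_eq0 addrAC subrr sub0r oppr_eq0 pnatr_eq0.
elim: lw => {w w0 dw} [||a v1 v2 _ IH1 _ IH2|m n v nm _].
- by constructor.
- by apply: lspan_gen; exists k.
- by apply: lspanD => //; apply: lspanZ.
apply: lspan_linear => [|{}v [j dv]]; first exact: lact_linearr.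
apply: lspan_gen; exists (j + (height T n - height T m))%N.
have le_mn : (height T m <= height T n)%N by rewrite leq_sub2l // ltnW.
rewrite lact_gradingE // dv lactZ -scalerDl -addSn natrD (natrB _ le_mn).
by congr (_ *: _); ring.
Qed.

End HighestWeight.

(** * Exchanging two adjacent indices of the order *)

Section AdjacentSwap.
Variables (K : numFieldType) (V : lieModType (gl_inf K)).
Variables (A B : seq int) (a b : int).
Hypothesis T_uniq : uniq (A ++ a :: b :: B).

Local Notation E := (E_ K).
Local Notation T := (A ++ a :: b :: B).
Local Notation T' := (A ++ b :: a :: B).

Let ab : a != b.
Proof.
by move: T_uniq; rewrite cat_uniq /= inE !negb_or -!andbA => /and5P[_ _ _ _ /andP[]].
Qed.

Let aA : a \notin A.
Proof. by move: T_uniq; rewrite cat_uniq /= !negb_or -!andbA => /and3P[]. Qed.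

Let bA : b \notin A.
Proof. by move: T_uniq; rewrite cat_uniq /= !negb_or -!andbA => /and4P[]. Qed.

Let index_a : index a T = size A.
Proof. by rewrite index_cat (negPf aA) /= eqxx addn0. Qed.

Let index_b : index b T = (size A).+1.
Proof. by rewrite index_cat (negPf bA) /= (negPf ab) eqxx addn1. Qed.

Let index_other n : n != a -> n != b ->
  ((index n T < size A) || ((size A).+1 < index n T))%N.
Proof.
move=> na nb; rewrite index_cat; have [nA|_] := boolP (n \in A).
  by rewrite index_mem nA.
by rewrite /= !(eq_sym _ n) (negPf na) (negPf nb) !addnS !ltnS leq_addr orbT.
Qed.

Let index_swap_a : index a T' = (size A).+1.
Proof. by rewrite index_cat (negPf aA) /= eq_sym (negPf ab) eqxx addn1. Qed.

Let index_swap_b : index b T' = size A.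
Proof. by rewrite index_cat (negPf bA) /= eqxx addn0. Qed.

Let index_swap n : n != a -> n != b -> index n T' = index n T.
Proof.
move=> na nb; rewrite !index_cat; case: ifP => // _.
by rewrite /= !(eq_sym _ n) (negPf na) (negPf nb).
Qed.

Variables (mu : int -> K) (w : V).
Hypothesis hw : highest_weight T mu w.

Local Notation f j := (iter j (lact (E b a)) w).

(* These [E m n] span a subalgebra normalised by [E b a]. *)
Lemma annihilated_string j m n : m != n -> (index m T <= index n T)%N ->
  (m, n) != (a, b) -> lact (E m n) (f j) = 0.
Proof.
case: hw => _ aw _; elim: j m n => [|j IH] m n mn le_mn mnab; first exact: aw.
rewrite iterS lactEE IH // lact0 add0r.
case: eqP => [nb|_]; case: eqP => [ma|_]; rewrite ?subr0 ?sub0r //.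
- by rewrite nb ma eqxx in mnab.
- have ma : m != a by apply: contraNneq mnab => ma; rewrite nb ma.
  have mb : m != b by rewrite -nb.
  have /orP mi := index_other ma mb.
  apply: IH => //; last by rewrite xpair_eqE (negPf ma).
  by move: le_mn; rewrite nb index_a index_b; lia.
have nb : n != b by apply: contraNneq mnab => nb; rewrite nb ma.
have na : n != a by rewrite -ma eq_sym.
have /orP ni := index_other na nb.
suff -> : lact (E b n) (f j) = 0 by rewrite oppr0.
apply: IH; first by rewrite eq_sym.
  by move: le_mn; rewrite ma index_a index_b; lia.
by rewrite xpair_eqE (eq_sym b a) (negPf ab).
Qed.

Variable k : nat.
Hypothesis mu_ab : mu a - mu b = k%:R.

(** The vector is singular: [E a b] kills it because the [sl_2] coefficient vanishes at [k.+1], and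
    [annihilated_string] covers the other pairs. *)
Lemma adjacent_nilpotent : irreducible V -> f k.+1 = 0.
Proof.
case: (hw) => w0 aw ww irrV; have [d dw] := grading_weight T ww.
have idx : (index a T <= index b T)%N by rewrite index_a index_b.
apply: (singular_eq0 (k := k) irrV T_uniq hw _ (weight_vector_iter _ _ _ ww) dw).
  move=> m n mn le_mn; have [[-> ->]|/eqP mnab] := (m, n) =P (a, b).
    rewrite (sl2_raise _ ab (aw _ _ ab idx) ww) mu_ab -[k.+1]addn1 natrD.
    by rewrite opprD addrA subrr sub0r addNr mulr0 scale0r.
  exact: annihilated_string.
(* Adjacent heights differ by exactly 1, so each [E b a] lowers the degree by 1. *)
elim: k.+1 => [|j IH]; first by rewrite subr0.
rewrite iterS lact_gradingE // IH lactZ -scalerDl; congr (_ *: _).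
rewrite /height index_a index_b size_cat /= -[j.+1]addn1 natrD.
have -> : (size A + (size B).+2 - size A = (size B).+2)%N by lia.
have -> : (size A + (size B).+2 - (size A).+1 = (size B).+1)%N by lia.
by rewrite -[(size B).+2]addn1 natrD; ring.
Qed.

(** The bottom of the string has the reflected weight. Only the pair [a], [b] changes its relative
    order, and [E b a] kills the bottom by [adjacent_nilpotent]. *)
Lemma highest_weight_swap : irreducible V ->
  highest_weight T'
    (fun n => if n == a then mu b else if n == b then mu a else mu n) (f k).
Proof.
move=> irrV; case: (hw) => w0 aw ww.
have idx : (index a T <= index b T)%N by rewrite index_a index_b.
split; first exact: (sl2_string_neq0 ab w0 (aw _ _ ab idx) ww mu_ab).
  move=> m n mn le_mn; have [[-> ->]|/eqP mnba] := (m, n) =P (b, a).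
    exact: adjacent_nilpotent.
  have mnab : (m, n) != (a, b).
    apply/eqP => -[ma nb]; move: le_mn.
    by rewrite ma nb index_swap_a index_swap_b ltnn.
  apply: annihilated_string => //; move: le_mn mnba mnab mn; rewrite !xpair_eqE.
  have [->|ma] := eqVneq m a; have [->|na] := eqVneq n a;
    have [mb|mb] := eqVneq m b; have [nb|nb] := eqVneq n b;
    rewrite ?mb ?nb ?eqxx //= ?index_a ?index_b;
    rewrite ?index_swap_a ?index_swap_b ?index_swap //;
    by [have := index_other na nb; lia | have := index_other ma mb; lia].
move=> n; rewrite (weight_vector_iter _ _ _ ww) -mu_ab; congr (_ *: _).
have [->|na] := eqVneq n a; first by rewrite (negPf ab) /=; ring.
by have [->|nb] := eqVneq n b; rewrite /=; ring.
Qed.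

End AdjacentSwap.

(** * Local nilpotency from a dominant weight *)

Section Integrability.
Variables (K : numFieldType) (V : lieModType (gl_inf K)).
Hypothesis irrV : irreducible V.

Local Notation E := (E_ K).

Definition nat_diff : rel K := fun x y => `[< exists k : nat, x - y = k%:R >].

(* Swapping [c] leftwards until it follows [a] reduces to the adjacent case. *)
Lemma nilpotent_vector (A M B : seq int) (a c : int) mu (w : V) :
    uniq (A ++ a :: rcons M c ++ B) ->
    highest_weight (A ++ a :: rcons M c ++ B) mu w ->
    pairwise nat_diff (map mu (a :: rcons M c)) ->
  exists2 v : V, v != 0 & exists N, iter N (lact (E c a)) v = 0.
Proof.
elim/last_ind: M B mu w => [|M b IH] B mu w.
  rewrite /= !andbT => Tu hw /asboolP[k muac].
  have [w0 _ _] := hw.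
  by exists w => //; exists k.+1; apply: (adjacent_nilpotent Tu hw).
have defT x y : A ++ a :: rcons (rcons M x) y ++ B = (A ++ a :: M) ++ x :: y :: B.
  by rewrite !cat_rcons -catA.
rewrite defT => Tu hw.
rewrite -[_ :: rcons _ _]/(rcons (a :: rcons M b) c) map_rcons.
rewrite pairwise_rcons -[a :: rcons M b]/(rcons (a :: M) b) map_rcons.
rewrite all_rcons => /andP[/andP[/asboolP[k mubc] _]].
have := highest_weight_swap Tu hw mubc irrV; set mu' := fun n => _ => hw' mu_dom.
have Tu' : uniq ((A ++ a :: M) ++ c :: b :: B).
  rewrite -(perm_uniq (s1 := (A ++ a :: M) ++ b :: c :: B)) //.
  by rewrite perm_cat2l (perm_catCA [:: b] [:: c] B).
have defT' : A ++ a :: rcons M c ++ (b :: B) = (A ++ a :: M) ++ c :: b :: B.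
  by rewrite cat_rcons -catA.
apply: (IH (b :: B) mu'); rewrite ?defT' //; first exact: hw'.
rewrite -[a :: rcons M c]/(rcons (a :: M) c) map_rcons.
(* The new weight gives [c] the old value at [b], so the list of values is a prefix of the old one
   and stays dominant. *)
have -> : mu' c = mu b.
  have /negPf cb : c != b.
    by apply/eqP => cb; move: Tu'; rewrite cat_uniq /= cb inE eqxx !andbF.
  by rewrite /mu' cb eqxx.
suff -> : map mu' (a :: M) = map mu (a :: M) by [].
apply/eq_in_map => n nM; move: Tu'; rewrite cat_uniq => /and3P[_ /hasPn disj _].
rewrite /mu'; case: eqP => [nb|_].
  by have := disj b; rewrite !inE eqxx orbT mem_cat -nb nM orbT => /(_ isT).
case: eqP => [nc|//].
by have := disj c; rewrite !inE eqxx mem_cat -nc nM orbT => /(_ isT).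
Qed.

(** Unless [q] precedes [p], [E p q] already kills [w]; this includes every [q] outside [T].
    Otherwise [nilpotent_vector] applies to the segment of [T] from [q] to [p]. *)
Lemma dominant_locally_nilpotent (T : seq int) mu (w : V) : uniq T ->
    highest_weight T mu w -> pairwise nat_diff (map mu T) ->
  forall p q : int, p != q -> p \in T ->
    locally_nilpotent (fun v : V => lact (E p q) v).
Proof.
move=> Tu hw mu_dom p q pq pT.
suff [u u0 nil_u] : exists2 v : V, v != 0 & exists N, iter N (lact (E p q)) v = 0.
  by apply: (irreducible_full irrV (submodule_E_nilpotent V pq) nil_u).
have [w0 aw ww] := hw.
have [le_pq|lt_qp] := leqP (index p T) (index q T).
  by exists w => //; exists 1; apply: aw.
have /splitPr def_T := pT; case: def_T => T1 T2 in Tu hw mu_dom lt_qp *.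
move: (Tu); rewrite cat_uniq => /and3P[_ /hasPn/(_ p) pT1 _].
rewrite inE eqxx /= in pT1; have {}pT1 := pT1 isT.
have qT1 : q \in T1.
  move: lt_qp; rewrite !index_cat (negPf pT1) /= eqxx addn0.
  by case: ifP => // _; rewrite ltnNge leq_addr.
have /splitPr def_T1 := qT1; case: def_T1 => A M in Tu hw mu_dom *.
have defT : (A ++ q :: M) ++ p :: T2 = A ++ q :: rcons M p ++ T2.
  by rewrite cat_rcons -catA.
apply: (nilpotent_vector (A := A) (M := M) (B := T2) (mu := mu) (w := w)).
- by rewrite -defT.
- by rewrite -defT.
move: mu_dom; rewrite defT map_cat pairwise_cat => /and3P[_ _].
by rewrite -[q :: _]/((q :: rcons M p) ++ T2) map_cat pairwise_cat => /and3P[].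
Qed.

End Integrability.

(** * Homomorphisms out of an induced module *)

Section InducedHom.
Variables (K : fieldType) (P L : lieAlgType K) (phi : P -> L) (V : lieModType P).
Variables (W : lieModType L) (f : induced phi V -> W).
Hypothesis f_hom : module_hom f.

Lemma env_act0 a : env_act a (0 : W) = 0.
Proof.
have := env_act_linearr a (-1) (0 : W) 0.
by rewrite scaler0 addr0 scaleN1r addNr.
Qed.

Lemma module_hom_tens a v : f (tens phi a v) = env_act a (f (tens phi 1 v)).
Proof.
have [f_lin f_act] := f_hom.
pose g (s : fralg K L) : W := f (tens phi (epi s) v).
pose h (s : fralg K L) : W := fralg_act s (f (tens phi 1 v)).
have g_lin : linear g.
  move=> k p q.
  have epiP : epi (k *: p + q) = k *: epi p + epi q by exact: api_linear.
  by rewrite /g epiP tens_linearl f_lin.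
have h_lin : linear h by exact: fralg_act_linearl.
suff gh : g =1 h by rewrite -{1}[a]erepK; exact: gh.
apply: (@eq_fralg K L W g h g_lin h_lin) => -[w].
rewrite /h fralg_act_word /g; elim: w => [|x w IH] /=.
  congr (f (tens phi _ v)); rewrite -epi1; congr (epi _).
  by rewrite fwordE; congr << _ >>; apply: val_inj; rewrite /= fm1.
have -> : fword K (FMonom (x :: w)) = fgen K x * fword K (FMonom w).
  by rewrite fwordM; congr fword; apply: val_inj; rewrite /= fmM fmU.
by rewrite epiM -/(env_in x) -lact_tens f_act IH.
Qed.

End InducedHom.

(** * Truncation to a subalgebra *)

Section GlSubTheory.
Variables (K : fieldType) (D : trel).

Lemma subE_out m n : ~~ D m n -> subE K D m n = 0.
Proof. by move=> /negPf Dmn; apply: val_inj; rewrite val_subE Dmn. Qed.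

Lemma glresK : cancel (val : glsub K D -> gl_inf K) (@glres K D).
Proof.
move=> x; apply: val_inj; rewrite [RHS]malg_eq_lext /glres /lext.
have val0 : val (0 : glsub K D) = 0 by [].
rewrite big_seq [RHS]big_seq.
apply: (big_ind2 (fun (y : glsub K D) z => val y = z)) => [//|y _ z _ <- <-|].
  by have := glval_linear 1 y z; rewrite !scale1r.
move=> [m n] /(allP (valP x)) /= Dmn.
have := glval_linear ((val x)@_(m, n)) (subE K D m n) 0.
by rewrite val0 !addr0 val_subE Dmn E_E.
Qed.

End GlSubTheory.

(** * The highest weight vector of the irreducible quotient *)

Section HighestWeightVector.
Variables (K : numFieldType) (S : {fset int}) (lam : {scalar cartan K}).
Variable V : lieModType (gl_inf K).

Local Notation E := (E_ K).

Lemma exists_highest_weight_vector :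
    (forall m, supp lam m -> m \in S) -> is_L_Slam S lam V ->
  exists w : V, [/\ w != 0, forall m n, n \notin S -> lact (E m n) w = 0,
    forall m n, m \in S -> n \in S -> m < n -> lact (E m n) w = 0
    & weight_vector (fun n => lam (EH K n)) w].
Proof.
move=> lamS [U [irrU [v [v0 v_sing v_wt] v_gen]]] [[[x x0] _] [f f_hom f_surj]].
have [f_lin f_act] := f_hom.
have f1_lin : linear (fun u => f (tens (@par_incl K S) 1 u)).
  by move=> k a b; rewrite tens_linearr f_lin.
pose f1 : U -> V := fun u => f (tens (@par_incl K S) 1 (u : infl U)).
have f1D k a b : f1 (k *: a + b) = k *: f1 a + f1 b by exact: f1_lin.
have f10 : f1 0 = 0 by have := f1D (-1) 0 0; rewrite scaler0 addr0 scaleN1r addNr.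
have f1Z k a : f1 (k *: a) = k *: f1 a by rewrite -[k *: a]addr0 f1D f10 addr0.
(* The parabolic subalgebra acts on [1 ⊗ U] through [par_proj], which keeps only the entries in
   [S × S]. *)
have f1E m n u : par_rel S m n -> lact (E m n) (f1 u) =
    f1 (if (m \in S) && (n \in S) then lact (ES K S m n) u else 0).
  move=> Dmn; have incl : E m n = par_incl (subE K (par_rel S) m n).
    by rewrite /par_incl val_subE Dmn.
  rewrite /f1 -f_act {1}incl (lact_tens1 _ _ (par_incl_hom K S)).
  congr (f (tens _ _ _)).
  rewrite -[LHS]/(lact (par_proj (subE K (par_rel S) m n)) u).
  rewrite /par_proj val_subE Dmn glresE; case: ifP => // mnS.
  by rewrite subE_out ?lact0l //= mnS.
exists (f1 v); split.
(* If the image of [v] were zero, [f] would vanish on the generators [1 ⊗ U], hence everywhere,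
   though it is onto a nonzero module. *)
- apply/eqP => fv0; have fu0 : forall u, f1 u = 0.
    apply: v_gen fv0; split=> // [k a b fa fb|y u fu].
      by rewrite f1D fa fb scaler0 addr0.
    rewrite -[y]glresK /glres /lext.
    elim/big_rec: _ => [|[m n] z _ fz]; first by rewrite lact0l.
    rewrite lact_linearl f1D fz addr0 /=.
    have [mnS|mnS] := boolP ((m \in S) && (n \in S)); last first.
      by rewrite subE_out // lact0l f10 scaler0.
    have := @f1E m n u; rewrite /= mnS orbT => /(_ isT) <-.
    by rewrite fu lact0 scaler0.
  have f0 m : f m = 0.
    have f0_lin : linear (fun _ : M_SU U => 0 : V).
      by move=> k a b; rewrite scaler0 addr0.
    apply: (eq_ind f_lin f0_lin) => a u.
    by rewrite (module_hom_tens f_hom) -/(f1 u) fu0 env_act0.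
  by have [m fm] := f_surj x; rewrite -fm f0 eqxx in x0.
- by move=> m n nS; rewrite f1E /= ?nS // (negPf nS) andbF f10.
- move=> m n mS nS mn; rewrite f1E /= ?mS ?nS ?orbT //= .
  by rewrite v_sing ?f10.
move=> n; have [nS|nS] := boolP (n \in S).
  by rewrite f1E /= ?nS //= v_wt // f1Z.
rewrite f1E /= ?nS // (negPf nS) f10.
have -> : lam (EH K n) = 0 by apply/eqP; apply: contraNT nS => /lamS.
by rewrite scale0r.
Qed.

End HighestWeightVector.

(** * The integrability criterion *)

Lemma exists_notin_fset (S : {fset int}) : exists j, j \notin S.
Proof.
exists (1 + \sum_(s <- S) `|s|); apply/negP => jS.
set j := (1 + _) in jS; have : `|j| <= \sum_(s <- S) `|s|.
  by rewrite (big_fsetD1 j) //= lerDl sumr_ge0.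
by apply/negP; rewrite -ltNge (lt_le_trans _ (ler_norm j)) // /j ltrDr.
Qed.

Theorem proposition3p19 (R : realType) (S : {fset int})
    (lam : {scalar cartan R[i]}) (L : lieModType (gl_inf R[i])) :
  S != fset0 ->
  (forall m : int, supp lam m -> m \in S) ->
  is_L_Slam S lam L ->
  (integrable L <-> P_plus S lam).
Proof.
move=> _ lamS LS; have irrL : irreducible L by case: LS => U _ [].
have [w [w0 w_plus w_sing w_wt]] := exists_highest_weight_vector lamS LS.
split=> [[_ nilL]|[lam_nat lam_out lam_dec]].
  have lam0 i : i \notin S -> lam (EH _ i) = 0.
    by move=> iS; apply/eqP; apply: contraNT iS => /lamS.
  have lam_diff a b : a != b -> lact (E_ _ a b) w = 0 ->
      exists k : nat, lam (EH _ a) - lam (EH _ b) = k%:R.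
    move=> ab ew; have [|N fN] := nilL b a _ w; first by rewrite eq_sym.
    exact: sl2_integral ab w0 ew w_wt fN.
  split=> // [i|i j iS jS ij].
    have [iS|iS] := boolP (i \in S); last by exists 0; rewrite lam0.
    (* Comparing with an index where [lam] vanishes makes [lam] at [i] itself a natural number. *)
    have [j jS] := exists_notin_fset S.
    have [|k] := lam_diff i j _ (w_plus _ _ jS).
      by apply: contraNneq jS => <-.
    by rewrite (lam0 j) // subr0; exists k.
  have [|k lam_ij] := lam_diff i j _ (w_sing _ _ iS jS ij); first by rewrite lt_eqF.
  by rewrite -subr_ge0 lam_ij ler0n.
split=> [n v|p q pq].
  apply: (lspan_seq (G := fun u => exists c, lact (E_ _ n n) u = c *: u)).
    by move=> a u [c nu]; exists c; rewrite lactZ nu !scalerA mulrC.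
  apply: (irreducible_full irrL (submodule_E_semisimple L n) _ w0).
  by apply: lspan_gen; exists (lam (EH _ n)); apply: w_wt.
pose s := sort <=%O (S : seq int).
(* The list must contain [p]. Putting it last is harmless: [E m n] kills [w] whenever [n] is outside
   [S], and the value 0 at [p] is minimal. *)
pose T := s ++ (if p \in S then [::] else [:: p]).
have s_mem i : (i \in s) = (i \in S) by rewrite mem_sort.
have s_uniq : uniq s by rewrite sort_uniq fset_uniq.
have T_uniq : uniq T.
  rewrite cat_uniq s_uniq; case: ifP => //= pS.
  by rewrite s_mem pS.
have hw : highest_weight T (fun n => lam (EH _ n)) w.
  split=> // m n mn; have [nS|nS _] := boolP (n \in S); last exact: w_plus.
  rewrite !index_cat !s_mem nS; have [mS|_] := boolP (m \in S); last first.
    rewrite leqNgt (leq_trans _ (leq_addr _ _)) // index_mem s_mem //.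
  have s_sorted : sorted <=%O s by apply: sort_le_sorted.
  move/(sorted_leq_index le_trans le_refl s_sorted); rewrite !s_mem => /(_ mS nS).
  by move=> le_mn; apply: w_sing; rewrite // lt_neqAle mn.
have dom i j : lam (EH _ j) <= lam (EH _ i) ->
    nat_diff (lam (EH _ i)) (lam (EH _ j)).
  have [k ->] := lam_nat i; have [l ->] := lam_nat j; rewrite ler_nat => lk.
  by apply/asboolP; exists (k - l)%N; rewrite natrB.
have T_dom : pairwise (@nat_diff _) (map (fun n => lam (EH _ n)) T).
  rewrite pairwise_map pairwise_cat; apply/and3P; split.
  - case: ifPn => [|pS]; first by rewrite allrel0r.
    apply/allrelP => i j _; rewrite inE => /eqP->; apply: dom.
    by rewrite (lam_out p) //; have [k ->] := lam_nat i; rewrite ler0n.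
  - have : pairwise <%O s.
      by rewrite -(sorted_pairwise lt_trans) sort_lt_sorted fset_uniq.
    apply: (sub_in_pairwise (P := mem S)).
      by move=> i j iS jS ij; apply/dom/lam_dec.
    by apply/allP => i; rewrite s_mem.
  by case: ifP.
apply: (dominant_locally_nilpotent irrL T_uniq hw T_dom pq).
by rewrite mem_cat s_mem; case: ifP; rewrite ?inE ?eqxx.
Qed.
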